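(* Let $|0\rangle,|\phi\rangle\in\mathcal H_Q$ be unit vectors with $\langle\phi|0\rangle\neq 0$, let $\mathcal E_{Q\to Q}$ be a quantum channel (the probe), and set $\rho_Q^0=\mathcal E(|0\rangle\langle0|)$, $\rho_Q^1=\mathcal E(|\phi\rangle\langle\phi|)$, assuming $\operatorname{supp}\rho_Q^1\subseteq\operatorname{supp}\rho_Q^0$. Let $m_x,\ell\ge1$ be integers and $E^m$ a finite-dimensional system. For $x\in\{1,\dots,m_x\}$ let $\tilde\sigma^x_{Q^{m_x}}=|0\rangle\langle0|^{\otimes(x-1)}\otimes|\phi\rangle\langle\phi|\otimes|0\rangle\langle0|^{\otimes(m_x-x)}$ and $\tilde\tau^x_{Q^{m_x}}=\mathcal E^{\otimes m_x}(\tilde\sigma^x_{Q^{m_x}})$. Let $U:\mathcal H_Q^{\otimes m_x}\to\mathcal H_Q^{\otimes m_x}\otimes\mathcal H_{E^m}$ be any isometry (Eve's attack, applied identically to each block), and define $\tau^x_{Q^{m_x}E^m}=U\tilde\tau^x U^\dagger$, $\tau_{XQ^{m_x}E^m}=\frac1{m_x}\sum_{x=1}^{m_x}|x\rangle\langle x|_X\otimes\tau^x_{Q^{m_x}E^m}$, $\sigma_{X^\ell Q^{m_x\ell}E^n}=\tau_{XQ^{m_x}E^m}^{\otimes\ell}$, $\tilde\rho^0_{Q^{m_x}}=(\rho_Q^0)^{\otimes m_x}$, $\rho^0_{Q^{m_x}E^m}=U\tilde\rho^0U^\dagger$. Let $\delta_0=C(|0\rangle\langle0|,\rho_Q^0)$,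 $\delta_1=C(|\phi\rangle\langle\phi|,\rho_Q^1)$, $\delta=\delta_0+\delta_1$, $f_0=F(|0\rangle\langle0|,|\phi\rangle\langle\phi|)$. Let $\eta^x\in(0,1)$, $x=1,\dots,m_x$, be such that, with $\lambda^x=2\delta_0+\sqrt{\eta^x+4\sqrt{\eta^x}\delta_1+4\delta_1^2}$, $$F(\tau^x_{Q^{m_x}},\rho^0_{Q^{m_x}})\le\aleph(\lambda^x,f_0)-2\sqrt{1-f_0}\,\delta-\delta^2\quad\text{for all }x.$$ Then for every smoothing parameter $\varepsilon\in(0,1)$, $$\mathbb H_{\min}^{\varepsilon}(X^\ell|E^n)_\sigma\ge\log m_x-D(\rho_Q^1\|\rho_Q^0)+\frac1{m_x}\sum_{x=1}^{m_x}\log(1-\eta^x)-(2\log m_x+3)\sqrt{\frac{\log\frac1\varepsilon+1}{\ell}}.$$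
   Context: All Hilbert spaces are finite-dimensional; logs are base 2. Fidelity: $F(\rho,\sigma)=\|\sqrt\rho\sqrt\sigma\|_1^2$ with $\|X\|_1=\operatorname{tr}\sqrt{X^\dagger X}$; $C(\rho,\sigma)=\sqrt{1-F(\rho,\sigma)}$. Quantum relative entropy $D(\rho\|\sigma)=\operatorname{tr}\rho(\log\rho-\log\sigma)$ (or $+\infty$ if the support condition fails). For $x\ge0$, $y\in(0,1]$: $\aleph(x,y)=1-\frac{2\sqrt{1-y}\,x+x^2}{y}-2\sqrt{\frac{2\sqrt{1-y}\,x+x^2}{y}}\,x-x^2$. $\tau^x_{Q^{m_x}}$ and $\rho^0_{Q^{m_x}}$ denote the marginals on $Q^{m_x}$ (Bob's system) of the corresponding states; $E^n=(E^m)^{\otimes \ell}$ and $X^\ell$ is the classical register of $\sigma$. $\mathbb H_{\min}^\varepsilon(X|E)$ is the $\varepsilon$-smooth conditional min-entropy in the sense of Renner (Security of QKD, 2005). *)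

(* Defs.v *)
From HB Require Import structures.
From Stdlib Require Import ClassicalEpsilon.
From mathcomp Require Import all_boot all_order all_algebra.
From mathcomp Require Import all_classical all_reals.
From mathcomp Require Import ereal exp.
From mathcomp Require Import complex.

Set Implicit Arguments.
Unset Strict Implicit.
Unset Printing Implicit Defensive.

Import Order.TTheory GRing.Theory Num.Theory.
Local Open Scope ring_scope.

Section QInfo.
Variable R : realType.
Local Notation C := R[i].

(** base-2 logarithm (ln 0 = 0 in MathComp-Analysis) *)
Definition log2 (x : R) : R := ln x / ln 2.

(** Linear maps between finite-dimensional Hilbert spaces C^S, C^T are
    represented by their matrices indexed by finite types:
    [A : mx S T] has entries [A s t] (rows S, columns T).
    Tensor products of systems are products of index types. *)
Definition mx (S T : finType) := S -> T -> C.
Definition op (T : finType) := mx T T.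

Definition mxmul (S T U : finType) (A : mx S T) (B : mx T U) : mx S U :=
  fun i k => \sum_(j : T) A i j * B j k.
Definition adj (S T : finType) (A : mx S T) : mx T S :=
  fun j i => conjc (A i j).
Definition idop (T : finType) : op T := fun i j => (i == j)%:R.
Definition trace (T : finType) (A : op T) : C := \sum_(i : T) A i i.
Definition opsub (T : finType) (A B : op T) : op T := fun i j => A i j - B i j.

Definition psd (T : finType) (A : op T) : Prop :=
  forall v : T -> C, 0 <= \sum_(i : T) \sum_(j : T) conjc (v i) * A i j * v j.
Definition density (T : finType) (A : op T) : Prop := psd A /\ trace A = 1.

(** support inclusion supp A ⊆ supp B (support = range for Hermitian ops) *)
Definition supp_incl (T : finType) (A B : op T) : Prop :=
  forall v : T -> C, exists w : T -> C,
    forall i, \sum_j A i j * v j = \sum_j B i j * w j.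

Definition unit_vec (T : finType) (v : T -> C) : Prop :=
  \sum_(i : T) conjc (v i) * v i = 1.
Definition inner (T : finType) (u v : T -> C) : C := \sum_(i : T) conjc (u i) * v i.
Definition ketbra (T : finType) (v : T -> C) : op T := fun i j => v i * conjc (v j).

Definition is_isometry (S T : finType) (U : mx T S) : Prop :=
  mxmul (adj U) U = @idop S.

(** Functional calculus via a spectral decomposition A = V diag(d) V^dagger
    (V unitary, d real); only applied to positive semidefinite operators. *)
Definition diagop (T : finType) (d : T -> C) : op T := fun i j => (i == j)%:R * d i.
Definition spectral (T : finType) (A : op T) (p : op T * (T -> R)) : Prop :=
  mxmul (adj p.1) p.1 = @idop T /\
  A = mxmul (mxmul p.1 (diagop (fun i => (p.2 i)%:C%C))) (adj p.1).
Definition spec (T : finType) (A : op T) : op T * (T -> R) :=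
  epsilon (inhabits ((fun _ _ => 0) : op T, fun _ : T => 0 : R)) (spectral A).
Definition funop (T : finType) (f : R -> R) (A : op T) : op T :=
  mxmul (mxmul (spec A).1 (diagop (fun i => (f ((spec A).2 i))%:C%C))) (adj (spec A).1).
Definition sqrtop (T : finType) (A : op T) : op T := funop Num.sqrt A.
Definition logop (T : finType) (A : op T) : op T := funop log2 A.

Definition tnorm (S T : finType) (X : mx S T) : R :=
  complex.Re (trace (sqrtop (mxmul (adj X) X))).
Definition fidelity (T : finType) (rho sigma : op T) : R :=
  tnorm (mxmul (sqrtop rho) (sqrtop sigma)) ^+ 2.
Definition Cdist (T : finType) (rho sigma : op T) : R :=
  Num.sqrt (1 - fidelity rho sigma).

Definition relent (T : finType) (rho sigma : op T) : \bar R :=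
  if `[< supp_incl rho sigma >] then
    (complex.Re (trace (mxmul rho (opsub (logop rho) (logop sigma)))))%:E
  else +oo%E.

Definition aleph (x y : R) : R :=
  let a := (2 * Num.sqrt (1 - y) * x + x ^+ 2) / y in
  1 - a - 2 * Num.sqrt a * x - x ^+ 2.

Definition opow (n : nat) (T : finType) (A : op T) : op {ffun 'I_n -> T} :=
  fun i j => \prod_(t < n) A (i t) (j t).
Definition ptr2 (S T : finType) (A : op (S * T)%type) : op S :=
  fun i j => \sum_(t : T) A (i, t) (j, t).
Definition relabel (S T : finType) (g : S -> T) (A : op T) : op S :=
  fun i j => A (g i) (g j).

Definition eunit (T : finType) (a b : T) : op T :=
  fun i j => ((i == a) && (j == b))%:R.
Definition is_channel (Q : finType) (E : op Q -> op Q) : Prop :=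
  (forall (c : C) (A B : op Q),
      E (fun i j => c * A i j + B i j) = (fun i j => c * E A i j + E B i j)) /\
  (forall A : op Q, trace (E A) = trace A) /\
  (forall (K : finType) (Z : op (K * Q)%type), psd Z ->
      psd (fun p p' : (K * Q)%type => E (fun a b => Z (p.1, a) (p'.1, b)) p.2 p'.2)).
(** E^{\otimes n}, as the linear extension to all operators on Q^n *)
Definition chanpow (n : nat) (Q : finType) (E : op Q -> op Q)
  (X : op {ffun 'I_n -> Q}) : op {ffun 'I_n -> Q} :=
  fun i j => \sum_(k : {ffun 'I_n -> Q}) \sum_(l : {ffun 'I_n -> Q})
    X k l * \prod_(t < n) E (eunit (k t) (l t)) (i t) (j t).

(** smooth conditional min-entropy (Renner 2005) *)
Definition Hmin_rel (A B : finType) (rho : op (A * B)%type) (sigma : op B) : \bar R :=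
  ereal_sup [set y : \bar R | exists l : R,
    (0 < l /\ psd (fun p q : (A * B)%type =>
        (l%:C%C) * ((p.1 == q.1)%:R * sigma p.2 q.2) - rho p q))
    /\ y = (- log2 l)%:E].
Definition ball (T : finType) (eps : R) (rho : op T) : set (op T) :=
  [set rb | psd rb /\ tnorm (opsub rb rho) <= complex.Re (trace rho) * eps].
Definition Hmin_smooth (A B : finType) (eps : R) (rho : op (A * B)%type) : \bar R :=
  ereal_sup [set y : \bar R | exists (sigma : op B) (rb : op (A * B)%type),
    density sigma /\ ball eps rho rb /\ y = Hmin_rel rb sigma].

End QInfo.

(* Main.v *)
(** The factors [log (1 - eta x)] are nonpositive, so the fidelity hypotheses
    are irrelevant and it suffices to treat
    [log m - D(rho1 || rho0) - (2 log m + 3) s], where [s] is the square root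
    in the statement.  Everything happens before Eve's isometry: an operator
    inequality and an approximation for the probe states survive [U] and the
    partial trace.

    Let [T] be the block-diagonal state [(1/m) (+)_x tau^x] and
    [S = 1 (x) omega], with [omega] the average of the [tau^x], so [T <= S].
    With [T = V diag(a) V^*], [S = W diag(b) W^*] and [u = W^* V], the numbers
    [a_i |u_ji|^2] form a probability distribution (Nussbaum-Szkola) under
    which the mean of [ln (b/a)] is the conditional entropy of [T]; Klein's
    inequality for [omega] against [rho0^{(x) m}] bounds it below by
    [ln m - D(rho1 || rho0)], up to the base of the logarithm.  Damping the
    matrix [V sqrt(diag a)], in the bases [V] and [W], by the weights
    [lam b_j / (a_i + lam b_j)] gives a matrix [N'] with [N' N'^* <= lam S];
    this is the arithmetic-geometric mean inequality for the operator norm.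
    The Hilbert-Schmidt distance to the undamped matrix is a tail probability
    of the Nussbaum-Szkola distribution, which on [l] tensor copies is bounded
    by Chernoff's method.  The moments needed depend only on [m], because
    [b/a] has mean at most [m] and, by [T <= S], [a/b] has mean at most 1. *)

Require Import Defs.
From HB Require Import structures.
From mathcomp Require Import all_boot all_order all_algebra.
From mathcomp Require Import all_classical all_reals.
From mathcomp Require Import ereal exp.
From mathcomp Require Import complex.
From Stdlib Require Import ClassicalEpsilon.
From mathcomp Require Import topology normedtype sequences derive realfun.
From mathcomp Require Import spectral sesquilinear ring lra.
Import Order.TTheory GRing.Theory Num.Theory.
Import numFieldNormedType.Exports.
Local Open Scope ring_scope.

Set Implicit Arguments.
Unset Strict Implicit.
Unset Printing Implicit Defensive.

(** * Scalar inequalities *)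

Section Scalar.
Variable R : realType.
Implicit Types x y z : R.

Lemma expR_ge_quad x : 0 <= x -> 1 + x + x ^+ 2 / 2 <= expR x.
Proof.
move=> x0.
pose f t : R := expR t - (1 + t + t ^+ 2 / 2).
have df t : is_derive t (1:R) f (expR t - (1 + t)).
  apply: is_derive_eq => /=.
  by rewrite /GRing.scale /=; field.
have cf : {within `[0, +oo[, continuous f}%classic.
  apply: derivable_within_continuous => t _; exact: ex_derive.
have : f 0 <= f x.
  apply: (@ger0_derive1_ndecry R f 0 _ _ cf 0 x (lexx _) x0).
  - by move=> t _; exact: ex_derive.
  - move=> t _; rewrite derive1E derive_val subr_ge0; exact: expR_ge1Dx.
by rewrite /f expR0 expr0n /= mul0r !addr0 subrr subr_ge0.
Qed.

(** After multiplication by [expR (- x)] the claim reads [f 0 <= f x], and [f] has derivative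
    [t (1 - e^-t)], nonnegative for [t >= 0]. *)
Lemma expR_le_quad_nonneg x : 0 <= x -> expR x <= 1 + x + x ^+ 2 / 2 * expR x.
Proof.
move=> x0.
pose f t : R := (1 + t) * expR (- t) + t ^+ 2 / 2.
have df t : is_derive t (1:R) f (t * (1 - expR (- t))).
  apply: is_derive_eq => /=.
  by rewrite /GRing.scale /=; field.
have cf : {within `[0, +oo[, continuous f}%classic.
  apply: derivable_within_continuous => t _; exact: ex_derive.
have : f 0 <= f x.
  apply: (@ger0_derive1_ndecry R f 0 _ _ cf 0 x (lexx _) x0).
  - by move=> t _; exact: ex_derive.
  - move=> t; rewrite in_itv /= andbT => t0.
    rewrite derive1E derive_val mulr_ge0 ?(ltW t0) // subr_ge0.
    by rewrite expR_le1 oppr_le0 ltW.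
rewrite /f oppr0 expR0 expr0n /= mul0r !addr0 mulr1 => h.
have := ler_wpM2r (expR_ge0 x) h.
have e := expRxMexpNx_1 x; have -> : 1 + x + x ^+ 2 / 2 * expR x =
  (1 + x) * (expR x * expR (- x)) + x ^+ 2 / 2 * expR x by rewrite e mulr1.
move=> h2; rewrite mul1r in h2; apply: (le_trans h2).
by rewrite le_eqVlt; apply/orP; left; apply/eqP; ring.
Qed.

(** Invert [expR_ge_quad] at [- x]; the two quadratics multiply to [1 + x^4 / 4 >= 1]. *)
Lemma expR_le_quad_nonpos x : x <= 0 -> expR x <= 1 + x + x ^+ 2 / 2.
Proof.
move=> x0; have y0 : 0 <= - x by rewrite oppr_ge0.
have h := expR_ge_quad y0.
have p : 0 < 1 + - x + (- x) ^+ 2 / 2 by have := sqr_ge0 (- x); lra.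
rewrite -[x in expR x]opprK expRN; apply: (le_trans (_ : _ <= (1 + - x + (- x) ^+ 2 / 2)^-1)).
  by rewrite lef_pV2 // posrE // (lt_le_trans p).
rewrite -div1r ler_pdivrMr // .
have -> : (1 + x + x ^+ 2 / 2) * (1 - x + (- x) ^+ 2 / 2) = 1 + x ^+ 4 / 4 by field.
by rewrite lerDl divr_ge0 // exprn_even_ge0.
Qed.

(** A second-order expansion in which [x^2] is traded for terms with controlled means: for [x] a
    log-likelihood ratio, [expR (x - M)] and [expR (- x)] will both average to at most 1. For
    [x > M] put [x = M + d] and use that [d] and [d^2] are at most [e^d]; for negative [x] the term
    [e^-x] must also absorb the remainder factor [e^(b |x|)], hence the bound on [b]. *)
Lemma moment_pointwise (M b x : R) : 0 <= M -> 0 < b <= 1 / 6 ->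
  expR (- (b * x)) <=
  1 - b * x + b ^+ 2 / 2 * (M ^+ 2 + (2 * M + 1) * expR (x - M) + expR (- x)).
Proof.
move=> M0 /andP[b0 b6].
have hb : 0 <= b ^+ 2 / 2 by rewrite divr_ge0 // sqr_ge0.
have [x0|x0] := leP 0 x.
  have := @expR_le_quad_nonpos (- (b * x)); rewrite oppr_le0 mulr_ge0 ?(ltW b0) //.
  move=> /(_ isT) /le_trans -> //; rewrite lerD2l sqrrN exprMn mulrAC ler_wpM2l //.
  rewrite (le_trans (_ : _ <= M ^+ 2 + (2 * M + 1) * expR (x - M))) //; last first.
    by rewrite lerDl expR_ge0.
  have [xM|/ltW] := leP x M.
    rewrite (le_trans (_ : _ <= M ^+ 2)) ?ler_sqr ?nnegrE // lerDl.
    by rewrite mulr_ge0 ?expR_ge0 // addr_ge0 // mulr_ge0.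
  rewrite -subr_ge0; set d := x - M => d0.
  have -> : x = M + d by rewrite /d addrC subrK.
  have d1 : d <= expR (d / 2).
    apply: le_trans (expR_ge_quad (_ : 0 <= d / 2)); last by rewrite divr_ge0.
    have := sqr_ge0 (d - 2); nra.
  have e2 : expR d = expR (d / 2) ^+ 2 by rewrite -expRM_natl mulrC divfK.
  have d2 : d ^+ 2 <= expR d by rewrite e2 ler_sqr // nnegrE expR_ge0.
  have d3 : d <= expR d by rewrite (le_trans _ (expR_ge1Dx d)) // lerDr.
  nra.
pose r := - x; have r0 : 0 < r by rewrite oppr_gt0.
have -> : x = - r by rewrite opprK.
rewrite mulrN !opprK.
have := @expR_le_quad_nonneg (b * r); rewrite mulr_ge0 ?(ltW b0) ?(ltW r0) //.
move=> /(_ isT) /le_trans -> //; rewrite lerD2l.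
have -> : (b * r) ^+ 2 / 2 * expR (b * r) = b ^+ 2 / 2 * (r ^+ 2 * expR (b * r)) by ring.
rewrite ler_wpM2l //.
(* The quadratic [1 - 7 r / 12 + 25 r^2 / 288] has negative discriminant. So [r^2] costs
   [e^(5 r / 6)], which leaves [e^(r / 6)] for the factor with [b]. *)
have r1 : r <= expR (5 / 12 * r).
  apply: le_trans (expR_ge_quad (_ : 0 <= 5 / 12 * r)); last by rewrite mulr_ge0 ?ltW // divr_ge0.
  have := sqr_ge0 (r - 3); nra.
have r2 : r ^+ 2 <= expR (5 / 6 * r).
  have -> : 5 / 6 * r = 2%:R * (5 / 12 * r) by field.
  by rewrite expRM_natl ler_sqr // nnegrE ?expR_ge0 // ltW.
have r3 : expR (b * r) <= expR (1 / 6 * r) by rewrite ler_expR ler_pM2r.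
have r4 : expR r = expR (5 / 6 * r) * expR (1 / 6 * r).
  by rewrite -expRD; congr expR; field.
rewrite (le_trans (_ : _ <= expR r)) ?lerDr //.
  by rewrite r4 ler_pM // ?sqr_ge0 ?expR_ge0.
by rewrite addr_ge0 ?sqr_ge0 // mulr_ge0 ?expR_ge0 // addr_ge0 // mulr_ge0.
Qed.

(** From [1/2 = 3/4 * 2/3] and [ln (1 + x) <= x] one gets [ln 2 >= 1/4 + 1/3 = 7/12]. The lower
    bound is chosen so that [c (17/4 - c) >= 2] for [c = ln 2], as used in [chernoff_parameters]. *)
Lemma ln2_bounds : 11 / 20 <= ln (2 : R) <= 1.
Proof.
have p : 0 < (3/4 : R) by lra. have q : 0 < (2/3 : R) by lra.
have h : ln (2^-1 : R) = ln (3/4) + ln (2/3).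
  by rewrite -lnM ?posrE //; congr ln; field.
rewrite lnV ?posrE // in h.
have h1 := @le_ln1Dx R (- (1/4)); have h2 := @le_ln1Dx R (- (1/3)).
have h3 := @le_ln1Dx R 1.
have E1 : 1 + - (1/4) = 3/4 :> R by field. have E2 : 1 + - (1/3) = 2/3 :> R by field.
rewrite E1 in h1; rewrite E2 in h2.
have := h1 ltac:(lra); have := h2 ltac:(lra); have := h3 ltac:(lra).
have -> : 1 + 1 = 2 :> R by [].
move=> *; lra.
Qed.

(* The exponent is [b = 2 c s / G] with [c = ln 2] and [G = M + 3 c / 2]; it
   turns the quadratic [b^2 V / 2 - 2 b G s + 2 c s^2], where
   [V = (M + 1)^2 + 1 <= G^2 / c], into something nonpositive. *)
Lemma chernoff_parameters (M h t s eps : R) (l : nat) :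
  (0 < l)%N -> 0 < eps < 1 -> ln 2 <= M -> h <= M -> 0 < s ->
  l%:R * s ^+ 2 * ln 2 = ln 2 - ln eps -> 0 < t -> t + (2 * M + 3 * ln 2) * s <= h ->
  exists2 b, 0 < b <= 1 / 6 &
  forall E : R, 0 <= E -> E <= 1 - b * h + b ^+ 2 / 2 * ((M + 1) ^+ 2 + 1) ->
    4 * (expR (b * t) * E ^+ l) <= eps ^+ 2.
Proof.
move=> l0 /andP[e0 e1]; have /andP[] := ln2_bounds; set c := ln 2 => c0 c1 cM hM s0 ls t0 th.
pose G := M + 3 / 2 * c; pose b := 2 * c * s / G.
have G0 : 0 < G by rewrite /G; lra.
have bG : b * G = 2 * c * s by rewrite /b divfK // gt_eqF.
have b0 : 0 < b by rewrite /b divr_gt0 // !mulr_gt0 //; lra.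
(* Since [t > 0] and [h <= M], the hypotheses force [2 G s <= M]. Then [12 c s G <= 6 c M <= G^2],
   the last step being [(M - 3 c / 2)^2 >= 0]. *)
have b6 : b <= 1 / 6.
  rewrite /b ler_pdivrMr //.
  have Gs : 2 * G * s <= M by rewrite /G; lra.
  rewrite -(ler_pM2r G0) -(ler_pM2l (_ : 0 < 6)) //.
  have /(ler_wpM2l (_ : 0 <= c)) : 2 * G * s <= M by [].
  move=> /(_ ltac:(lra)) H; have := sqr_ge0 (M - 3/2 * c); rewrite /G in H *; nra.
exists b; first by rewrite b0 b6.
move=> E E0 hE.
(* The difference of the two sides is [(1 - c) M^2 + c M + 9 c^2 / 4 - 2 c]. It increases with [M],
   and at [M = c] it is the expression in [k1]. *)
have V : c * ((M + 1) ^+ 2 + 1) <= G ^+ 2.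
  have k1 : 0 <= c * (c * (17/4 - c) - 2) by rewrite mulr_ge0; [done | lra | nra].
  have k2 : 0 <= c * (M - c) by rewrite mulr_ge0; [done | lra | lra].
  have k3 : 0 <= (1 - c) * (M ^+ 2 - c ^+ 2).
    by rewrite mulr_ge0 ?subr_ge0 // ler_sqr ?nnegrE //; lra.
  rewrite /G; nra.
have V2 : b ^+ 2 / 2 * ((M + 1) ^+ 2 + 1) <= 2 * c * s ^+ 2.
  rewrite -(ler_pM2l (_ : 0 < c)); last lra.
  have : b ^+ 2 / 2 * (c * ((M + 1) ^+ 2 + 1)) <= b ^+ 2 / 2 * G ^+ 2.
    by rewrite ler_wpM2l // divr_ge0 // sqr_ge0.
  have -> : b ^+ 2 / 2 * G ^+ 2 = 2 * c ^+ 2 * s ^+ 2.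
    by rewrite mulrAC -exprMn bG; field.
  by lra.
have hE2 : E <= expR (- (b * h) + 2 * c * s ^+ 2).
  apply: (le_trans hE); apply: le_trans (expR_ge1Dx _).
  by rewrite -addrA lerD2l lerD2l.
have hEl : E ^+ l <= expR (l%:R * (- (b * h) + 2 * c * s ^+ 2)).
  by rewrite expRM_natl lerXn2r ?nnegrE ?expR_ge0.
(* Everything moves into the exponent. Because [l >= 1], the single [b t] may be counted [l] times;
   the total is then at most [- 2 l c s^2 = - 2 (c - ln eps)], and the factor [4 = e^(2 c)] turns
   this into [2 ln eps]. *)
have e4 : 4 = expR (2 * c).
  rewrite expRM_natl lnK ?posrE //; ring.
have -> : eps ^+ 2 = expR (2 * ln eps) by rewrite expRM_natl lnK ?posrE.
rewrite (le_trans (_ : _ <= expR (2 * c) *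
  (expR (b * t) * expR (l%:R * (- (b * h) + 2 * c * s ^+ 2))))) //.
  by rewrite e4 !ler_wpM2l ?expR_ge0.
rewrite -!expRD ler_expR.
have l1 : 1 <= l%:R :> R by rewrite ler1n.
have bt : b * t <= l%:R * (b * t) by rewrite ler_peMl // mulr_ge0 ?ltW.
have : l%:R * (b * t + (- (b * h) + 2 * c * s ^+ 2) ) <= l%:R * (- (2 * c * s ^+ 2)).
  rewrite ler_wpM2l //.
  have : b * (t + 2 * G * s) <= b * h.
    apply: ler_wpM2l; first exact: ltW.
    by apply: le_trans th; rewrite /G; lra.
  have -> : b * (t + 2 * G * s) = b * t + 2 * (b * G) * s by ring.
  rewrite bG; lra.
have : l%:R * (2 * c * s ^+ 2) = 2 * (c - ln eps) by rewrite -ls; ring.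
lra.
Qed.
End Scalar.

(** * Matrices indexed by finite types *)

Section MatrixAlgebra.
Variable R : realType.
Local Notation C := R[i].
Implicit Types S T U I : finType.

Lemma mx_ext S T (A B : mx R S T) : (forall i j, A i j = B i j) -> A = B.
Proof. by move=> h; apply/funext => i; apply/funext => j. Qed.

Lemma mxmulA S T U I (A : mx R S T) (B : mx R T U) (D : mx R U I) :
  mxmul A (mxmul B D) = mxmul (mxmul A B) D.
Proof.
apply: mx_ext => i j; rewrite /mxmul.
under eq_bigr do rewrite big_distrr /=.
rewrite exchange_big /=; apply: eq_bigr => k _.
by rewrite big_distrl /=; apply: eq_bigr => t _; rewrite mulrA.
Qed.

Lemma adj_mul S T U (A : mx R S T) (B : mx R T U) :
  adj (mxmul A B) = mxmul (adj B) (adj A).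
Proof.
apply: mx_ext => i j; rewrite /adj /mxmul rmorph_sum; apply: eq_bigr => k _.
by rewrite rmorphM mulrC.
Qed.

Lemma adjK S T (A : mx R S T) : adj (adj A) = A.
Proof. by apply: mx_ext => i j; rewrite /adj conjcK. Qed.

Lemma mxmul_diagr S T (A : mx R S T) d : mxmul A (diagop d) = fun i j => A i j * d j.
Proof.
apply: mx_ext => i j; rewrite /mxmul (bigD1 j) //= big1 => [|k /negPf kj].
  by rewrite /diagop eqxx mul1r addr0.
by rewrite /diagop kj mul0r mulr0.
Qed.

Lemma mxmul_diagl S T (A : mx R S T) d : mxmul (diagop d) A = fun i j => d i * A i j.
Proof.
apply: mx_ext => i j; rewrite /mxmul (bigD1 i) //= big1 => [|k /negPf kj].
  by rewrite /diagop eqxx mul1r addr0.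
by rewrite /diagop eq_sym kj !mul0r.
Qed.

Lemma idop_diag T : @idop R T = diagop (fun=> 1).
Proof. by apply: mx_ext => i j; rewrite /idop /diagop mulr1. Qed.

Lemma mxmul1r S T (A : mx R S T) : mxmul A (@idop R T) = A.
Proof. by rewrite idop_diag mxmul_diagr; apply: mx_ext => i j; rewrite mulr1. Qed.

Lemma mxmul1l S T (A : mx R S T) : mxmul (@idop R S) A = A.
Proof. by rewrite idop_diag mxmul_diagl; apply: mx_ext => i j; rewrite mul1r. Qed.

Lemma conjR (x : R) : conjc (x%:C)%C = (x%:C)%C.
Proof. by rewrite /conjc /= oppr0. Qed.

Lemma adj_diag T (d : T -> R) :
  adj (diagop (fun i => (d i)%:C%C)) = diagop (fun i => (d i)%:C%C) :> op R T.
Proof.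
apply: mx_ext => i j; rewrite /adj /diagop rmorphM rmorph_nat eq_sym.
by have [->|ne] := eqVneq i j; [congr (_ * _); exact: conjR | rewrite /= !mul0r].
Qed.

Lemma trace_mulC S T (A : mx R S T) (B : mx R T S) : trace (mxmul A B) = trace (mxmul B A).
Proof.
rewrite /trace /mxmul exchange_big /=; apply: eq_bigr => i _.
by apply: eq_bigr => j _; rewrite mulrC.
Qed.

(** Bridge to matrices indexed by ordinals, where [mulmx1C] and the spectral theorem are
    available. *)
Definition toM S T (A : mx R S T) : 'M[C]_(#|S|, #|T|) :=
  \matrix_(i, j) A (enum_val i) (enum_val j).
Definition fromM S T (M : 'M[C]_(#|S|, #|T|)) : mx R S T :=
  fun i j => M (enum_rank i) (enum_rank j).

Lemma toMK S T (A : mx R S T) : fromM (toM A) = A.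
Proof. by apply: mx_ext => i j; rewrite /fromM mxE !enum_rankK. Qed.

Lemma fromMK S T (M : 'M[C]_(#|S|, #|T|)) : toM (fromM M) = M.
Proof. by apply/matrixP => i j; rewrite mxE /fromM !enum_valK. Qed.

Lemma toM_mul S T U (A : mx R S T) (B : mx R T U) : toM (mxmul A B) = toM A *m toM B.
Proof.
apply/matrixP => i j; rewrite !mxE /mxmul big_enum_val /=.
by apply: eq_bigr => k _; rewrite !mxE.
Qed.

Lemma fromM_mul S T U (A : 'M[C]_(#|S|, #|T|)) (B : 'M[C]_(#|T|, #|U|)) :
  fromM (A *m B) = mxmul (fromM A) (fromM B).
Proof. by rewrite -{1}[A]fromMK -{1}[B]fromMK -toM_mul toMK. Qed.

Lemma toM_id T : toM (@idop R T) = 1%:M.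
Proof. by apply/matrixP => i j; rewrite !mxE /idop (inj_eq enum_val_inj). Qed.

Lemma fromM_id T : fromM (1%:M : 'M[C]_#|T|) = @idop R T.
Proof. by rewrite -toM_id toMK. Qed.

Lemma mulmx_comm_id T (A B : op R T) : mxmul A B = @idop R T -> mxmul B A = @idop R T.
Proof.
move=> /(congr1 (@toM _ _)); rewrite toM_mul toM_id => /mulmx1C h.
by rewrite -[mxmul B A]toMK toM_mul h fromM_id.
Qed.

Definition normsq (z : C) : R := complex.Re z ^+ 2 + complex.Im z ^+ 2.

Lemma normsqE z : (normsq z)%:C%C = conjc z * z.
Proof. by case: z => a b; rewrite /normsq /=; simpc; congr (_ +i* _)%C; ring. Qed.

Lemma normsq_ge0 z : 0 <= normsq z. Proof. by rewrite addr_ge0 ?sqr_ge0. Qed.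

Lemma normsq_eq0 z : normsq z = 0 -> z = 0.
Proof.
case: z => a b; rewrite /normsq /= => /eqP; rewrite paddr_eq0 ?sqr_ge0 //.
by rewrite !sqrf_eq0 => /andP[/eqP -> /eqP ->].
Qed.

Lemma normsqM x y : normsq (x * y) = normsq x * normsq y.
Proof. by case: x y => [a b] [c d]; rewrite /normsq /=; simpc => /=; ring. Qed.

Lemma normsqR (x : R) : normsq x%:C%C = x ^+ 2.
Proof. by rewrite /normsq /= expr0n addr0. Qed.

Lemma normsq_conj z : normsq (conjc z) = normsq z.
Proof. by case: z => a b; rewrite /normsq /= sqrrN. Qed.

Lemma normsq0 : normsq 0 = 0. Proof. by rewrite /normsq /= expr0n addr0. Qed.

Lemma ReD (x y : C) : complex.Re (x + y) = complex.Re x + complex.Re y.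
Proof. by case: x y => [a b] [c d]. Qed.

Lemma Re_sum I (F : I -> C) : complex.Re (\sum_i F i) = \sum_i complex.Re (F i).
Proof.
by apply: (big_morph (fun z : C => complex.Re z)) => // x y; rewrite ReD.
Qed.

Lemma real_sum I (F : I -> R) : (\sum_i F i)%:C%C = \sum_i (F i)%:C%C.
Proof. exact: rmorph_sum. Qed.

Lemma normsq_sub x y : normsq (x - y) = normsq x + normsq y - 2 * complex.Re (conjc x * y).
Proof. by case: x y => [a b] [c d]; rewrite /normsq /=; simpc => /=; ring. Qed.

Definition hsnormsq S T (A : mx R S T) : R := \sum_i \sum_j normsq (A i j).

Lemma hsnormsqE S T (A : mx R S T) : (hsnormsq A)%:C%C = trace (mxmul (adj A) A).
Proof.
rewrite /hsnormsq /trace /mxmul exchange_big /= real_sum; apply: eq_bigr => i _.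
by rewrite real_sum; apply: eq_bigr => j _; rewrite normsqE.
Qed.

Lemma hsnormsq_ge0 S T (A : mx R S T) : 0 <= hsnormsq A.
Proof. by apply: sumr_ge0 => i _; apply: sumr_ge0 => j _; apply: normsq_ge0. Qed.

Lemma hsnormsq_eq0 S T (A : mx R S T) : hsnormsq A = 0 -> forall i j, A i j = 0.
Proof.
move=> h i j; apply: normsq_eq0; move/eqP: h; rewrite psumr_eq0 => [|k _]; last first.
  by apply: sumr_ge0 => *; apply: normsq_ge0.
move=> /allP /(_ i (mem_index_enum _)) /=; rewrite psumr_eq0 => [|k _]; last exact: normsq_ge0.
by move=> /allP /(_ j (mem_index_enum _)) /= /eqP.
Qed.

Lemma hsnormsq_adj S T (A : mx R S T) : hsnormsq (adj A) = hsnormsq A.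
Proof.
rewrite /hsnormsq exchange_big; apply: eq_bigr => i _; apply: eq_bigr => j _.
by rewrite /adj normsq_conj.
Qed.

Lemma hsnormsq_isometry S T U (V : mx R S T) (A : mx R T U) :
  mxmul (adj V) V = @idop R T -> hsnormsq (mxmul V A) = hsnormsq A.
Proof.
move=> h; apply: (@complexI R); rewrite !hsnormsqE adj_mul.
by rewrite mxmulA -[mxmul (mxmul (adj A) _) _]mxmulA h mxmul1r.
Qed.

(** The hypothesis says that [U] is a partial isometry, so [B = U U^* A] is an orthogonal projection
    of [A]. Both the norm squared of [B] and its inner product with [A] equal the left side; expand
    the norm of [A - B]. *)
Lemma bessel S I T (U : mx R S I) (A : mx R S T) :
  mxmul (mxmul U (adj U)) U = U -> hsnormsq (mxmul (adj U) A) <= hsnormsq A.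
Proof.
move=> hU; pose B := mxmul (mxmul U (adj U)) A.
have hU' J (X : mx R J S) : mxmul (mxmul (mxmul X U) (adj U)) U = mxmul X U.
  by rewrite -!mxmulA (mxmulA U) hU.
have hB : hsnormsq B = hsnormsq (mxmul (adj U) A).
  apply: (@complexI R); rewrite !hsnormsqE /B !adj_mul !adjK.
  rewrite !mxmulA; congr trace; congr mxmul.
  by rewrite hU'.
have e : \sum_i \sum_j complex.Re (conjc (A i j) * B i j) = hsnormsq B.
  apply: (@complexI R); rewrite hsnormsqE.
  have <- : trace (mxmul (adj A) B) = trace (mxmul (adj B) B).
    rewrite /B !adj_mul !adjK !mxmulA; congr trace; congr mxmul.
    by rewrite hU'.
  have tr : trace (mxmul (adj A) B) = \sum_i \sum_j conjc (A i j) * B i j.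
    by rewrite /trace /mxmul exchange_big.
  rewrite -(RRe_real (_ : trace (mxmul (adj A) B) \is Num.real)); last first.
    have -> : trace (mxmul (adj A) B) = (hsnormsq (mxmul (adj U) A))%:C%C.
      by rewrite hsnormsqE /B adj_mul adjK !mxmulA.
    by apply/complex_realP; exists (hsnormsq (mxmul (adj U) A)).
  congr (_ %:C)%C; rewrite tr Re_sum; apply: eq_bigr => i _; rewrite Re_sum //.
have : 0 <= hsnormsq (fun i j => A i j - B i j) by apply: hsnormsq_ge0.
rewrite /hsnormsq; under eq_bigr do under eq_bigr do rewrite normsq_sub.
under eq_bigr do rewrite sumrB big_split /=.
rewrite sumrB big_split /=; under [X in _ - X]eq_bigr do rewrite -mulr_sumr.
rewrite -mulr_sumr e -!/(hsnormsq _) hB; lra.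
Qed.

Lemma hs_cauchy_schwarz S T (A B : mx R S T) :
  complex.Re (trace (mxmul (adj A) B)) <= Num.sqrt (hsnormsq A) * Num.sqrt (hsnormsq B).
Proof.
have tr : complex.Re (trace (mxmul (adj A) B)) = \sum_i \sum_j complex.Re (conjc (A i j) * B i j).
  rewrite /trace /mxmul exchange_big /= Re_sum; apply: eq_bigr => i _.
  by rewrite Re_sum.
set a := Num.sqrt (hsnormsq A); set b := Num.sqrt (hsnormsq B).
have a2 : a ^+ 2 = hsnormsq A by rewrite sqr_sqrtr // hsnormsq_ge0.
have b2 : b ^+ 2 = hsnormsq B by rewrite sqr_sqrtr // hsnormsq_ge0.
(* Expand the norm squared of [b A - a B], with [a] and [b] the norms of [A] and [B]. Dividing by
   [a b] requires it to be positive; otherwise one of the matrices is zero. *)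
have key : 0 <= b ^+ 2 * a ^+ 2 + a ^+ 2 * b ^+ 2
     - 2 * (a * b * complex.Re (trace (mxmul (adj A) B))).
  have : 0 <= hsnormsq (fun i j => b%:C%C * A i j - a%:C%C * B i j) by apply: hsnormsq_ge0.
  rewrite /hsnormsq; under eq_bigr do under eq_bigr do rewrite normsq_sub !normsqM !normsqR.
  under eq_bigr do rewrite sumrB big_split /= -!mulr_sumr.
  rewrite sumrB big_split /= -!mulr_sumr -!/(hsnormsq _) -a2 -b2.
  suff -> : \sum_i \sum_j complex.Re (conjc (b%:C%C * A i j) * (a%:C%C * B i j)) =
     a * b * complex.Re (trace (mxmul (adj A) B)) by [].
  rewrite tr mulr_sumr; apply: eq_bigr => i _; rewrite mulr_sumr; apply: eq_bigr => j _.
  by case: (A i j) (B i j) => [x y] [z w] /=; ring.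
have a0 : 0 <= a by apply: sqrtr_ge0. have b0 : 0 <= b by apply: sqrtr_ge0.
have [ab|] := ltP 0 (a * b).
  have : a * b * complex.Re (trace (mxmul (adj A) B)) <= a * b * (a * b) by nra.
  by rewrite ler_pM2l.
move=> ab; have /eqP : a * b = 0 by apply/eqP; rewrite eq_le ab mulr_ge0.
rewrite mulf_eq0 => /orP[/eqP z|/eqP z].
- rewrite tr big1 => [|i _]; first by rewrite mulr_ge0.
  rewrite big1 // => j _; rewrite (hsnormsq_eq0 (_ : hsnormsq A = 0)) ?(@conjc0 R) ?mul0r //.
  by rewrite -a2 z expr0n.
- rewrite tr big1 => [|i _]; first by rewrite mulr_ge0.
  rewrite big1 // => j _; rewrite (hsnormsq_eq0 (_ : hsnormsq B = 0)) ?mulr0 //.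
  by rewrite -b2 z expr0n.
Qed.
End MatrixAlgebra.

(** * Spectral decompositions, positivity and the trace norm *)

Section Spectral.
Variable R : realType.
Local Notation C := R[i].
Implicit Types S T U I : finType.

Definition rdiag T (d : T -> R) : op R T := diagop (fun i => (d i)%:C%C).
Definition unitary T (V : op R T) := mxmul (adj V) V = @idop R T.

Definition qform T (A : op R T) (v : T -> C) : C :=
  \sum_i \sum_j conjc (v i) * A i j * v j.

Lemma unitaryC T (V : op R T) : unitary V -> mxmul V (adj V) = @idop R T.
Proof. exact: mulmx_comm_id. Qed.

Lemma real_complexM (x y : R) : (x * y)%:C%C = x%:C%C * y%:C%C :> C.
Proof. exact: rmorphM. Qed.

Lemma rdiag_mul T (d e : T -> R) : mxmul (rdiag d) (rdiag e) = rdiag (fun i => d i * e i).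
Proof.
rewrite /rdiag mxmul_diagr; apply: mx_ext => i j; rewrite /diagop.
by have [->|_] := eqVneq i j; rewrite ?mul1r ?mul0r ?real_complexM.
Qed.

Lemma rdiag1 T : rdiag (fun=> 1) = @idop R T.
Proof. by rewrite idop_diag. Qed.

Lemma qform_sandwich S T (K : mx R S T) (A : op R T) v :
  qform (mxmul (mxmul K A) (adj K)) v =
  qform A (fun t => \sum_s conjc (K s t) * v s).
Proof.
rewrite /qform.
transitivity (\sum_s \sum_s' \sum_t \sum_t'
   conjc (v s) * K s t * A t t' * conjc (K s' t') * v s').
  apply: eq_bigr => s _; apply: eq_bigr => s' _.
  rewrite /mxmul /adj big_distrr big_distrl /= exchange_big /=.
  under eq_bigr => t _.
    rewrite !big_distrl /= big_distrr big_distrl /=; over.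
  apply: eq_bigr => t' _; apply: eq_bigr => t _.
  by rewrite !mulrA.
rewrite (eq_bigr (fun s => \sum_t \sum_t' \sum_s'
   conjc (v s) * K s t * A t t' * conjc (K s' t') * v s')); last first.
  by move=> s _; rewrite exchange_big; apply: eq_bigr => t _; rewrite exchange_big.
rewrite exchange_big; apply: eq_bigr => t _; rewrite exchange_big; apply: eq_bigr => t' _.
rewrite rmorph_sum !big_distrl /=; apply: eq_bigr => s _.
rewrite big_distrr /=; apply: eq_bigr => s' _.
by rewrite rmorphM /= conjcK; ring.
Qed.

Lemma psd_sandwich S T (K : mx R S T) (A : op R T) :
  psd A -> psd (mxmul (mxmul K A) (adj K)).
Proof. by move=> h v; rewrite -/(qform _ v) qform_sandwich; apply: h. Qed.

Lemma qform_rdiag T (d : T -> R) v : qform (rdiag d) v = (\sum_i d i * normsq (v i))%:C%C.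
Proof.
rewrite /qform real_sum; apply: eq_bigr => i _; rewrite (bigD1 i) //= big1 => [|j /negPf ji].
  by rewrite /rdiag /diagop eqxx mul1r addr0 real_complexM normsqE; ring.
by rewrite /rdiag /diagop eq_sym ji mul0r mulr0 mul0r.
Qed.

Lemma psd_rdiag T (d : T -> R) : (forall i, 0 <= d i) -> psd (rdiag d).
Proof.
move=> h v; rewrite -/(qform _ v) qform_rdiag ler0c.
by apply: sumr_ge0 => i _; rewrite mulr_ge0 ?normsq_ge0.
Qed.

Lemma psd_gram S T (A : mx R S T) : psd (mxmul A (adj A)).
Proof.
by rewrite -[A in mxmul A _]mxmul1r; apply: psd_sandwich; rewrite -rdiag1; apply: psd_rdiag.
Qed.

(* Polarization on the span of two basis vectors. *)
Lemma psd_hermitian T (A : op R T) : psd A -> forall i j, A j i = conjc (A i j).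
Proof.
move=> h i j; pose q x y : T -> C := fun k => x * (k == i)%:R + y * (k == j)%:R.
have e x y : qform A (q x y) = conjc x * x * A i i + conjc x * y * A i j
   + conjc y * x * A j i + conjc y * y * A j j.
  have one (B : T -> C) (k : T) : \sum_l B l * (l == k)%:R = B k.
    rewrite (bigD1 k) //= big1 => [|l /negPf ->]; last by rewrite mulr0.
    by rewrite eqxx mulr1 addr0.
  rewrite /qform (eq_bigr (fun k => conjc (q x y k) * (A k i * x + A k j * y))); last first.
    move=> k _; transitivity (\sum_l (conjc (q x y k) * A k l * x) * (l == i)%:R
       + \sum_l (conjc (q x y k) * A k l * y) * (l == j)%:R).
      by rewrite -big_split; apply: eq_bigr => l _; rewrite /q /=; ring.
    rewrite (one (fun l => conjc (q x y k) * A k l * x)).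
    by rewrite (one (fun l => conjc (q x y k) * A k l * y)); ring.
  transitivity (\sum_k (conjc x * (A k i * x + A k j * y)) * (k == i)%:R
     + \sum_k (conjc y * (A k i * x + A k j * y)) * (k == j)%:R).
    rewrite -big_split; apply: eq_bigr => l _.
    by rewrite /q rmorphD !rmorphM !rmorph_nat /=; ring.
  rewrite (one (fun k => conjc x * (A k i * x + A k j * y))).
  rewrite (one (fun k => conjc y * (A k i * x + A k j * y))); ring.
have im x y : complex.Im (qform A (q x y)) = 0 by apply: ger0_Im; apply: h.
move: (im 1 0) (im 0 1) (im 1 1) (im 1 'i%C); rewrite !e.
case: (A i i) (A i j) (A j i) (A j j) => [a b] [c d] [f g] [p r] /=.
simpc => /= b0 r0 h1 h2; have -> : f = c by lra.
by have -> : g = - d by lra.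
Qed.

Lemma conj_conjc (x : C) : x^* = conjc x.
Proof. by []. Qed.

Lemma psd_spectral_ex T (A : op R T) : psd A -> exists p, spectral A p.
Proof.
move=> h; pose M := toM A.
have hM : M \is hermsymmx.
  apply/is_hermitianmxP; rewrite expr0 scale1r; apply/matrixP => i j.
  by rewrite !mxE (psd_hermitian h).
have /orthomx_spectralP E := hermitian_normalmx hM.
have /mxOverP dr := hermitian_spectral_diag_real hM.
have Pu := spectral_unitarymx M.
rewrite invmx_unitary // in E.
(* The decomposition obtained is [M = P^-1 D P] with [P] unitary, so the eigenvectors are the
   columns of the adjoint of [P]. *)
exists (adj (fromM (spectralmx M)), fun i => complex.Re (spectral_diag M 0 (enum_rank i))).
have ea : adj (fromM (spectralmx M)) = fromM (map_mx Num.conj (trmx (spectralmx M))).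
  by apply: mx_ext => i j; rewrite /adj /fromM !mxE conj_conjc.
split => /=.
  by rewrite adjK ea -fromM_mul (unitarymxP _) // fromM_id.
rewrite adjK -[A in LHS]toMK -/M {1}E !fromM_mul ea; congr mxmul; congr mxmul.
apply: mx_ext => i j; rewrite /fromM /diagop !mxE (inj_eq enum_rank_inj).
by have [->|_] := eqVneq i j; rewrite /= ?mul0r // mul1r (RRe_real (dr _ _)).
Qed.

Lemma spectral_ge0 T (A : op R T) p : psd A -> spectral A p -> forall i, 0 <= p.2 i.
Proof.
move=> h [u e] i; rewrite -ler0c; have := psd_sandwich (adj p.1) h.
rewrite e !mxmulA u mxmul1l adjK -mxmulA u mxmul1r => /(_ (fun k => (k == i)%:R)).
rewrite -/(qform _ _) qform_rdiag (bigD1 i) //= big1 => [|k /negPf ->].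
  by rewrite eqxx /normsq /= expr0n !addr0 expr1n mulr1.
by rewrite normsq0 mulr0.
Qed.

Lemma specP T (A : op R T) : psd A -> spectral A (spec A).
Proof. by move=> /psd_spectral_ex; apply: epsilon_spec. Qed.

(** With [D = N' - N] the difference of Gram matrices is [N' D^* + D N^*]. The polar decomposition
    writes its trace norm as a trace against partial isometries, and Cauchy-Schwarz with [bessel]
    bounds each of the two terms by the norm of [D]. *)
Lemma tnorm_gram_le S T (N N' : mx R S T) : hsnormsq N <= 1 -> hsnormsq N' <= 1 ->
  tnorm (opsub (mxmul N' (adj N')) (mxmul N (adj N))) <=
  2 * Num.sqrt (hsnormsq (fun i j => N' i j - N i j)).
Proof.
move=> h1 h2; set X := opsub _ _; set D := fun i j => _.
have hX : psd (mxmul (adj X) X) by have := psd_gram (adj X); rewrite adjK.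
rewrite /tnorm /sqrtop /funop; case: (spec _) (specP hX) (spectral_ge0 hX (specP hX)).
move=> V d [/= u e] d0.
have -> : trace (mxmul (mxmul V (diagop (fun i => (Num.sqrt (d i))%:C%C))) (adj V))
  = (\sum_i Num.sqrt (d i))%:C%C.
  rewrite trace_mulC mxmulA u mxmul1l /trace real_sum; apply: eq_bigr => i _.
  by rewrite /diagop eqxx mul1r.
(* Left singular vectors of [X], the numbers [sqrt (d i)] being the singular values. By [0^-1 = 0]
   the columns at zero singular values vanish, so [U] is only a partial isometry, which is what
   [bessel] asks for. *)
pose U := mxmul (mxmul X V) (rdiag (fun i => (Num.sqrt (d i))^-1)).
have XV : mxmul (adj (mxmul X V)) (mxmul X V) = rdiag d.
  rewrite adj_mul -mxmulA (mxmulA (adj X)) e.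
  by rewrite -!mxmulA u mxmul1r mxmulA u mxmul1l.
have aU : adj U = mxmul (rdiag (fun i => (Num.sqrt (d i))^-1)) (adj (mxmul X V)).
  by rewrite /U adj_mul /rdiag adj_diag.
have UX : mxmul (adj U) (mxmul X V) = rdiag (fun i => Num.sqrt (d i)).
  rewrite aU -mxmulA XV rdiag_mul; congr rdiag; apply/funext => i.
  have [-> |nz] := eqVneq (Num.sqrt (d i)) 0.
    by rewrite invr0 mul0r.
  by rewrite -{2}(sqr_sqrtr (d0 i)) expr2 mulKf.
have UU : mxmul (mxmul U (adj U)) U = U.
  rewrite -mxmulA {3}/U (mxmulA (adj U)) UX rdiag_mul {1}/U -mxmulA rdiag_mul /U.
  congr mxmul; congr rdiag; apply/funext => i.
  have [->|nz] := eqVneq (Num.sqrt (d i)) 0; first by rewrite invr0 mul0r.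
  by rewrite divff // mulr1.
clearbody U.
have VV : mxmul (mxmul V (adj V)) V = V by rewrite -mxmulA u mxmul1r.
have XE : X = fun i j => mxmul N' (adj D) i j + mxmul D (adj N) i j.
  apply: mx_ext => i j; rewrite /X /opsub /mxmul /adj /D -big_split -sumrB /=.
  by apply: eq_bigr => k _; rewrite rmorphB; ring.
have mulDl (J K L : finType) (A : mx R J K) (B B' : mx R K L) :
  mxmul A (fun i j => B i j + B' i j) = fun i j => mxmul A B i j + mxmul A B' i j.
  by apply: mx_ext => i j; rewrite /mxmul -big_split; apply: eq_bigr => k _; rewrite mulrDr.
have mulDr (J K L : finType) (A A' : mx R J K) (B : mx R K L) :
  mxmul (fun i j => A i j + A' i j) B = fun i j => mxmul A B i j + mxmul A' B i j.
  by apply: mx_ext => i j; rewrite /mxmul -big_split; apply: eq_bigr => k _; rewrite mulrDl.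
have -> : \sum_i Num.sqrt (d i) = complex.Re (trace (mxmul (adj (mxmul (adj N') U)) (mxmul (adj D) V)))
   + complex.Re (trace (mxmul (adj (mxmul (adj D) U)) (mxmul (adj N) V))).
  rewrite -ReD !adj_mul !adjK.
  have -> : forall A B : op R S, trace A + trace B = trace (fun i j => A i j + B i j).
    by move=> A B; rewrite /trace big_split.
  have -> : (fun i j => mxmul (mxmul (adj U) N') (mxmul (adj D) V) i j +
      mxmul (mxmul (adj U) D) (mxmul (adj N) V) i j) = mxmul (adj U) (mxmul X V).
    by rewrite XE mulDr mulDl !mxmulA.
  rewrite UX /trace /= Re_sum.
  by apply: eq_bigr => i _; rewrite /rdiag /diagop eqxx mul1r.
have b (J K L: finType) (A : mx R J K) (Y : mx R J L) : mxmul (mxmul Y (adj Y)) Y = Y ->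
  Num.sqrt (hsnormsq (mxmul (adj A) Y)) <= Num.sqrt (hsnormsq A).
  by move=> hY; rewrite ler_wsqrtr // -hsnormsq_adj adj_mul adjK; apply: bessel.
have s1 (J K : finType) (A : mx R J K) : hsnormsq A <= 1 -> Num.sqrt (hsnormsq A) <= 1.
  by move=> hA; rewrite -sqrtr1 ler_wsqrtr.
rewrite mulr_natl mulr2n; apply: lerD; apply: le_trans (hs_cauchy_schwarz _ _) _.
- rewrite -[X in _ <= X]mul1r ler_pM ?sqrtr_ge0 ?b //.
  by rewrite (le_trans (b _ _ _ _ _ UU)) ?s1.
- rewrite -[X in _ <= X]mulr1 ler_pM ?sqrtr_ge0 ?b //.
  by rewrite (le_trans (b _ _ _ _ _ VV)) ?s1.
Qed.
End Spectral.

(** * Smoothing in two eigenbases *)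

Section Smoothing.
Variable R : realType.
Local Notation C := R[i].
Implicit Types S T U I : finType.

Lemma conjM (x y : C) : conjc (x * y) = conjc x * conjc y.
Proof. exact: rmorphM. Qed.

Lemma mxmulBr S T U (A : mx R S T) (B D : mx R T U) :
  mxmul A (fun i j => B i j - D i j) = fun i j => mxmul A B i j - mxmul A D i j.
Proof.
by apply: mx_ext => i j; rewrite /mxmul -sumrB; apply: eq_bigr => k _; rewrite mulrBr.
Qed.

Lemma mxmulBl S T U (A B : mx R S T) (D : mx R T U) :
  mxmul (fun i j => A i j - B i j) D = fun i j => mxmul A D i j - mxmul B D i j.
Proof.
by apply: mx_ext => i j; rewrite /mxmul -sumrB; apply: eq_bigr => k _; rewrite mulrBl.
Qed.

Lemma sandwichB S T (K : mx R S T) (A B : op R T) :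
  mxmul (mxmul K (opsub A B)) (adj K) =
  opsub (mxmul (mxmul K A) (adj K)) (mxmul (mxmul K B) (adj K)).
Proof. by rewrite /opsub mxmulBr mxmulBl. Qed.

Lemma qformB T (A B : op R T) v : qform (opsub A B) v = qform A v - qform B v.
Proof.
rewrite /qform -sumrB; apply: eq_bigr => i _; rewrite -sumrB; apply: eq_bigr => j _.
by rewrite /opsub mulrBr mulrBl.
Qed.

Lemma psd_subE T (A B : op R T) (f g : (T -> C) -> R) :
  (forall v, qform A v = (f v)%:C%C) -> (forall v, qform B v = (g v)%:C%C) ->
  psd (opsub A B) -> forall v, g v <= f v.
Proof.
move=> hA hB h v; have := h v; rewrite -/(qform _ v) qformB hA hB.
by rewrite subr_ge0 lecR.
Qed.

Lemma qform_spectral T (V : op R T) (d : T -> R) v :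
  qform (mxmul (mxmul V (rdiag d)) (adj V)) v =
  (\sum_i d i * normsq (\sum_j conjc (V j i) * v j))%:C%C.
Proof. by rewrite qform_sandwich qform_rdiag. Qed.

(* With [z = sqrt(a) x], [v = sqrt(c) y] and [x = M^* y], the eigenvalue equation
   gives [h |v|^2 + |z|^2 = Re <v, u z>], which is at most
   [|z|^2 + |v|^2 / 4].  When [a i = c j = 0] the entry of [M] is [0 / 0 = 0]. *)
Lemma gram_eigen_le (T : finType) (a c : T -> R) (u : op R T) (h : R) (y : T -> C)
    (M := fun j i => u j i * (Num.sqrt (a i * c j) / (a i + c j))%:C%C) :
  unitary u -> (forall i, 0 <= a i) -> (forall i, 0 <= c i) ->
  \sum_j normsq (y j) = 1 ->
  (forall j, \sum_i M j i * (\sum_k conjc (M k i) * y k) = h%:C%C * y j) -> h <= 1.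
Proof.
move=> hu a0 c0 y1 eig.
pose x i := \sum_k conjc (M k i) * y k.
have hx : h = \sum_i normsq (x i).
  apply: (@complexI R); rewrite real_sum -[LHS]mulr1.
  transitivity (h%:C%C * (\sum_j normsq (y j))%:C%C); first by rewrite y1.
  rewrite real_sum big_distrr /=.
  transitivity (\sum_j \sum_i conjc (y j) * M j i * x i).
    apply: eq_bigr => j _; rewrite normsqE mulrCA -eig big_distrr /=.
    by apply: eq_bigr => i _; rewrite mulrA.
  rewrite exchange_big; apply: eq_bigr => i _; rewrite normsqE {2}/x rmorph_sum big_distrl /=.
  by apply: eq_bigr => k _; rewrite conjM conjcK; ring.
pose v j : C := (Num.sqrt (c j))%:C%C * y j; pose z i : C := (Num.sqrt (a i))%:C%C * x i.
pose w j := \sum_i u j i * z i.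
pose v2 := \sum_j c j * normsq (y j); pose z2 := \sum_i a i * normsq (x i).
have E1 : \sum_j complex.Re (conjc (v j) * w j) = h * v2 + z2.
  have st j i : conjc (v j) * (u j i * z i) = (a i + c j)%:C%C * (conjc (y j) * M j i * x i).
    rewrite /v /z /M conjM conjR.
    have -> : forall A B Y Z X : C, A * Y * (Z * (B * X)) = Z * Y * X * (A * B).
      by move=> *; ring.
    have -> : forall A Y Z X D : C, A * (Y * (Z * D) * X) = Z * Y * X * (A * D).
      by move=> *; ring.
    congr (_ * _); rewrite -!real_complexM; congr (_ %:C)%C.
    have [s0|s0] := eqVneq (a i + c j) 0.
      have /eqP := s0; rewrite paddr_eq0 // => /andP[/eqP -> /eqP ->].
      by rewrite sqrtr0 mulr0 addr0 mul0r.
    by rewrite mulrCA divff // mulr1 sqrtrM // mulrC.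
  rewrite -Re_sum.
  have -> : \sum_j conjc (v j) * w j = (h * v2 + z2)%:C%C.
    transitivity (\sum_j \sum_i ((a i)%:C%C * (conjc (y j) * M j i * x i)
       + (c j)%:C%C * (conjc (y j) * M j i * x i))).
      apply: eq_bigr => j _; rewrite /w big_distrr /=; apply: eq_bigr => i _.
      by rewrite st rmorphD mulrDl.
    under eq_bigr do rewrite big_split /=.
    rewrite big_split /= addrC rmorphD /=; congr (_ + _).
      rewrite real_complexM real_sum big_distrr /=; apply: eq_bigr => j _.
      rewrite -big_distrr /= real_complexM normsqE.
      under eq_bigr do rewrite -mulrA.
      by rewrite -big_distrr /= eig; ring.
    rewrite exchange_big real_sum; apply: eq_bigr => i _ /=.
    rewrite -big_distrr /= real_complexM normsqE; congr (_ * _).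
    rewrite -big_distrl /=; congr (_ * _); rewrite /x rmorph_sum.
    by apply: eq_bigr => k _ /=; rewrite conjM conjcK mulrC.
  by [].
have E2 : \sum_j normsq (w j) = z2.
  have -> : z2 = \sum_i normsq (z i).
    by apply: eq_bigr => i _; rewrite /z normsqM normsqR sqr_sqrtr.
  have h1 (q : T -> C) : \sum_j normsq (q j) = hsnormsq (fun j (_ : unit) => q j).
    by apply: eq_bigr => j _; rewrite (big_pred1 tt) //; case.
  rewrite !h1 -[RHS](hsnormsq_isometry _ hu); congr hsnormsq.
have E3 : \sum_j normsq (v j) = v2.
  by apply: eq_bigr => i _; rewrite /v normsqM normsqR sqr_sqrtr.
have : 0 <= \sum_j normsq (2^-1%:C%C * v j - w j) by apply: sumr_ge0 => *; apply: normsq_ge0.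
under eq_bigr do rewrite normsq_sub normsqM normsqR.
rewrite sumrB big_split /= -!mulr_sumr E2 E3.
have -> : \sum_i complex.Re (conjc (2^-1%:C%C * v i) * w i) = 2^-1 * (h * v2 + z2).
  rewrite -E1 mulr_sumr; apply: eq_bigr => i _.
  by case: (v i) (w i) => [? ?] [? ?] /=; ring.
have : 0 <= v2 by rewrite -E3; apply: sumr_ge0 => *; apply: normsq_ge0.
move=> v2_ge0 key; have hv : h * v2 <= v2 by lra.
move: v2_ge0.
(* If [v2 = 0], each [k] has [c k = 0], which kills row [k] of [M], or [y k = 0]. Hence [x = 0] and
   [h = 0]. *)
rewrite le_eqVlt => /orP[/eqP v0|v0]; last by rewrite -(ler_pM2r v0) mul1r.
suff x0 i : x i = 0 by rewrite hx big1 // => i _; rewrite x0 normsq0.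
rewrite /x big1 // => k _.
have : c k * normsq (y k) = 0.
  have /eqP := esym v0; rewrite psumr_eq0 => [|j _]; last by rewrite mulr_ge0 ?normsq_ge0.
  by move=> /allP /(_ k (mem_index_enum _)) /eqP.
move=> /eqP; rewrite mulf_eq0 => /orP[/eqP ck|/eqP /normsq_eq0 ->]; last by rewrite mulr0.
by rewrite /M ck mulr0 sqrtr0 mul0r mulr0 (@conjc0 R) mul0r.
Qed.
End Smoothing.

(** * Damping in two eigenbases and the Nussbaum-Szkola distribution *)

Section NussbaumSzkola.
Variable R : realType.
Local Notation C := R[i].
Implicit Types S T U I : finType.

Lemma unitary_mul T (V W : op R T) : unitary V -> unitary W -> unitary (mxmul V W).
Proof. by move=> hV hW; rewrite /unitary adj_mul mxmulA -(mxmulA (adj W)) hV mxmul1r. Qed.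

Lemma unitary_adj T (V : op R T) : unitary V -> unitary (adj V).
Proof. by move=> hV; rewrite /unitary adjK; apply: unitaryC. Qed.

Lemma unitary_col T (u : op R T) i : unitary u -> \sum_j normsq (u j i) = 1.
Proof.
move=> /(congr1 (fun A : op R T => A i i)); rewrite /idop eqxx => h.
by apply: (@complexI R); rewrite real_sum -[RHS]h; apply: eq_bigr => j _; rewrite normsqE.
Qed.

Lemma unitary_row T (u : op R T) j : unitary u -> \sum_i normsq (u j i) = 1.
Proof.
move=> /unitary_adj /unitary_col => /(_ j) h; rewrite -[RHS]h.
by apply: eq_bigr => i _; rewrite /adj normsq_conj.
Qed.

(** Diagonalize [M M^*]; its eigenvectors are unit vectors, so [gram_eigen_le] bounds every
    eigenvalue by 1. *)
Lemma psd_one_sub_gram T (a c : T -> R) (u : op R T)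
    (M := fun j i => u j i * (Num.sqrt (a i * c j) / (a i + c j))%:C%C) :
  unitary u -> (forall i, 0 <= a i) -> (forall i, 0 <= c i) ->
  psd (opsub (@idop R T) (mxmul M (adj M))).
Proof.
move=> hu a0 c0; have [[Y h] /= [uY e]] := psd_spectral_ex (psd_gram M).
have hY : mxmul (mxmul M (adj M)) Y = mxmul Y (rdiag h) by rewrite e -mxmulA uY mxmul1r.
have -> : opsub (@idop R T) (mxmul M (adj M)) = mxmul (mxmul Y (rdiag (fun i => 1 - h i))) (adj Y).
  have -> : rdiag (fun i => 1 - h i) = opsub (@idop R T) (rdiag h).
    rewrite -rdiag1; apply: mx_ext => i j.
    by rewrite /opsub /rdiag /diagop rmorphB mulrBr.
  by rewrite sandwichB mxmul1r (unitaryC uY) e.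
apply/psd_sandwich/psd_rdiag => k; rewrite subr_ge0.
apply: (@gram_eigen_le R T a c u (h k) (fun j => Y j k)) => //.
  exact: unitary_col.
move=> j; have := congr1 (fun A : op R T => A j k) hY.
rewrite /rdiag mxmul_diagr mulrC => <-; rewrite -mxmulA.
by apply: eq_bigr => i _; congr (_ * _); apply: eq_bigr.
Qed.

Lemma smoothing T (V W : op R T) (a b : T -> R) (lam : R) (u := mxmul (adj W) V) :
  unitary V -> unitary W -> (forall i, 0 <= a i) -> (forall i, 0 <= b i) -> 0 < lam ->
  exists N' : op R T, [/\
    psd (opsub (fun i j => lam%:C%C * mxmul (mxmul W (rdiag b)) (adj W) i j)
               (mxmul N' (adj N'))),
    hsnormsq N' <= \sum_i a i &
    hsnormsq (fun i j => N' i j - mxmul V (rdiag (fun i => Num.sqrt (a i))) i j) =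
    \sum_i \sum_j a i * normsq (u j i) * (a i / (a i + lam * b j)) ^+ 2].
Proof.
move=> hV hW a0 b0 l0; pose c j := lam * b j.
have c0 j : 0 <= c j by rewrite mulr_ge0 // ltW.
have hu : unitary u by apply: unitary_mul => //; apply: unitary_adj.
pose M : op R T := fun j i => u j i * (Num.sqrt (a i * c j) / (a i + c j))%:C%C.
(* In the basis [W], the matrix [V sqrt(diag a)] has entries [u_ji sqrt(a_i)], and [Z] is its damped
   version. Pulling out [sqrt(c_j)] leaves the [M] of [psd_one_sub_gram], so that
   [Z Z^* <= diag c]. *)
pose Z := mxmul (rdiag (fun j => Num.sqrt (c j))) M.
have ZE j i : Z j i = u j i * (Num.sqrt (a i) * (c j / (a i + c j)))%:C%C.
  rewrite /Z /rdiag mxmul_diagl /M mulrCA -real_complexM; congr (_ * (_ %:C)%C).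
  rewrite (sqrtrM _ (a0 i)); transitivity (Num.sqrt (c j) ^+ 2 * Num.sqrt (a i) / (a i + c j)).
    by ring.
  by rewrite sqr_sqrtr //; ring.
have s0 i j : a i + c j = 0 -> a i = 0.
  by move/eqP; rewrite paddr_eq0 // => /andP[/eqP].
exists (mxmul W Z); split.
- have -> : (fun i j => lam%:C%C * mxmul (mxmul W (rdiag b)) (adj W) i j)
     = mxmul (mxmul W (rdiag c)) (adj W).
    apply: mx_ext => i j; rewrite /rdiag !mxmul_diagr /mxmul big_distrr /=.
    by apply: eq_bigr => k _; rewrite /c real_complexM; ring.
  rewrite adj_mul (mxmulA (mxmul W Z)) -(mxmulA W Z) -sandwichB; apply: psd_sandwich.
  have -> : opsub (rdiag c) (mxmul Z (adj Z)) =
    mxmul (mxmul (rdiag (fun j => Num.sqrt (c j))) (opsub (@idop R T) (mxmul M (adj M))))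
      (adj (rdiag (fun j => Num.sqrt (c j)))).
    rewrite sandwichB mxmul1r /Z adj_mul !mxmulA {4}/rdiag adj_diag -/(rdiag _) rdiag_mul.
    by congr opsub; congr rdiag; apply/funext => i; rewrite -expr2 sqr_sqrtr.
  by apply: psd_sandwich; apply: psd_one_sub_gram.
- rewrite hsnormsq_isometry // /hsnormsq exchange_big; apply: ler_sum => i _ /=.
  rewrite -[X in _ <= X]mulr1 -(unitary_col i hu) mulr_sumr; apply: ler_sum => j _.
  rewrite ZE normsqM normsqR exprMn sqr_sqrtr // mulrCA ler_wpM2l // ler_piMr ?normsq_ge0 //.
  rewrite expr_le1 // ?divr_ge0 // ?addr_ge0 //.
  have [->|nz] := eqVneq (a i + c j) 0; first by rewrite invr0 mulr0.
  by rewrite ler_pdivrMr ?mul1r ?lerDr // lt_def nz addr_ge0.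
- have VE : V = mxmul W u by rewrite /u mxmulA unitaryC // mxmul1l.
  have -> : (fun i j => mxmul W Z i j - mxmul V (rdiag (fun i => Num.sqrt (a i))) i j) =
     mxmul W (fun i j => Z i j - mxmul u (rdiag (fun i => Num.sqrt (a i))) i j).
    by rewrite mxmulBr mxmulA -VE.
  rewrite hsnormsq_isometry // /hsnormsq exchange_big; apply: eq_bigr => i _; apply: eq_bigr => j _ /=.
  rewrite ZE /rdiag mxmul_diagr -mulrBr -rmorphB normsqM normsqR -[X in _ - X]mulr1 -mulrBr.
  rewrite exprMn sqr_sqrtr // mulrA [normsq _ * _]mulrC -/(c j).
  have [h0|nz] := eqVneq (a i + c j) 0; first by rewrite (s0 _ _ h0) !mul0r.
  by congr (_ * _); field.
Qed.

(** Conjugation into the eigenbasis [W] of the dominating operator makes the inequality a scalar one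
    in the overlaps [u], the form used from here on. *)
Lemma domination_quad T (V W : op R T) (a b : T -> R) (u := mxmul (adj W) V) :
  unitary W ->
  psd (opsub (mxmul (mxmul W (rdiag b)) (adj W)) (mxmul (mxmul V (rdiag a)) (adj V))) ->
  forall y, \sum_i a i * normsq (\sum_j conjc (u j i) * y j) <= \sum_j b j * normsq (y j).
Proof.
move=> hW /(psd_sandwich (adj W)); rewrite sandwichB adjK.
have -> : mxmul (mxmul (adj W) (mxmul (mxmul W (rdiag b)) (adj W))) W = rdiag b.
  by rewrite !mxmulA hW mxmul1l -mxmulA hW mxmul1r.
have -> : mxmul (mxmul (adj W) (mxmul (mxmul V (rdiag a)) (adj V))) W =
   mxmul (mxmul u (rdiag a)) (adj u).
  by rewrite /u adj_mul adjK !mxmulA.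
by apply: psd_subE => v; [rewrite qform_rdiag | rewrite qform_spectral].
Qed.

(** Test on the [j]-th basis vector: the right side is [b j = 0], the left side a sum of the
    nonnegative terms in question. *)
Lemma domination_supp T (a b : T -> R) (u : op R T) :
  (forall i, 0 <= a i) ->
  (forall y, \sum_i a i * normsq (\sum_j conjc (u j i) * y j) <= \sum_j b j * normsq (y j)) ->
  forall i j, b j = 0 -> a i * normsq (u j i) = 0.
Proof.
move=> a0 h i j bj; have := h (fun k => (k == j)%:R).
rewrite [X in _ <= X]big1 => [|k _]; last first.
  by have [->|_] := eqVneq k j; rewrite ?bj ?mul0r // normsq0 mulr0.
have one i' : \sum_k conjc (u k i') * (k == j)%:R = conjc (u j i').
  rewrite (bigD1 j) //= big1 => [|k /negPf ->]; last by rewrite mulr0.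
  by rewrite eqxx mulr1 addr0.
under eq_bigr do rewrite one normsq_conj.
move=> le; have /eqP : \sum_i a i * normsq (u j i) = 0.
  apply/eqP; rewrite eq_le le; apply: sumr_ge0 => k _; exact: mulr_ge0 (a0 _) (normsq_ge0 _).
rewrite psumr_eq0 => [|k _]; last by rewrite mulr_ge0 ?normsq_ge0.
by move=> /allP /(_ i (mem_index_enum _)) /eqP.
Qed.

(* Test the domination on the vector [u_ji / b_j]; terms with [b_j = 0] drop out
   because of the convention [0^-1 = 0]. *)
Lemma domination_inv T (a b : T -> R) (u : op R T) :
  (forall i, 0 <= a i) -> (forall i, 0 <= b i) ->
  (forall y, \sum_i a i * normsq (\sum_j conjc (u j i) * y j) <= \sum_j b j * normsq (y j)) ->
  forall i, a i * \sum_j normsq (u j i) / b j <= 1.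
Proof.
move=> a0 b0 h i; set s := \sum_j _.
have s0 : 0 <= s by apply: sumr_ge0 => j _; rewrite divr_ge0 ?normsq_ge0.
have := h (fun j => ((b j)^-1)%:C%C * u j i).
have -> : \sum_j b j * normsq (((b j)^-1)%:C%C * u j i) = s.
  apply: eq_bigr => j _; rewrite normsqM normsqR; have [->|nz] := eqVneq (b j) 0.
    by rewrite invr0 mulr0 mul0r.
  by field.
move=> le; have : a i * s ^+ 2 <= s.
  apply: le_trans le; rewrite (bigD1 i) //= -[X in X <= _]addr0 lerD //; last first.
    by apply: sumr_ge0 => k _; rewrite mulr_ge0 ?normsq_ge0.
  rewrite (_ : \sum_j _ = s%:C%C) ?normsqR // /s real_sum; apply: eq_bigr => j _.
  by rewrite real_complexM normsqE; ring.
have [->|nz] := eqVneq s 0; first by rewrite mulr0.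
by rewrite expr2 mulrA -[X in _ <= X]mul1r ler_pM2r // lt_def nz.
Qed.

(** Average [moment_pointwise] at [x = ln (b j / a i)] over the weights [a i * q j i]. The weighted
    [expR (x - M)] becomes [e^-M q b], of sum at most 1 since [q] is doubly stochastic; the weighted
    [expR (- x)] is controlled by the hypothesis on [q / b]. The constants add up as
    [M^2 + (2 M + 1) + 1]. *)
Lemma ns_moment T (a b : T -> R) (q : T -> T -> R) (M bt : R)
    (h := \sum_i \sum_j a i * q j i * (ln (b j) - ln (a i))) :
  (forall j i, 0 <= q j i) -> (forall i, \sum_j q j i = 1) -> (forall j, \sum_i q j i = 1) ->
  (forall i, 0 <= a i) -> (forall i, 0 <= b i) -> \sum_i a i = 1 ->
  \sum_i b i <= expR M -> 0 <= M ->
  (forall i j, b j = 0 -> a i * q j i = 0) ->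
  (forall i, a i * \sum_j q j i / b j <= 1) -> 0 < bt <= 1 / 6 ->
  \sum_i \sum_j a i * q j i * expR (- (bt * (ln (b j) - ln (a i)))) <=
  1 - bt * h + bt ^+ 2 / 2 * ((M + 1) ^+ 2 + 1).
Proof.
move=> q0 qc qr a0 b0 a1 bM M0 supp inv hbt.
have bt2 : 0 <= bt ^+ 2 / 2 by rewrite divr_ge0 ?sqr_ge0.
have k0 : 0 <= (2 * M + 1) * expR (- M) by rewrite mulr_ge0 ?expR_ge0 // addr_ge0 // mulr_ge0.
apply: le_trans (_ : \sum_i \sum_j (a i * q j i
  - bt * (a i * q j i * (ln (b j) - ln (a i)))
  + bt ^+ 2 / 2 * (M ^+ 2 * (a i * q j i)
     + (2 * M + 1) * expR (- M) * (q j i * b j)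
     + a i * (a i * (q j i / b j)))) <= _).
  apply: ler_sum => i _; apply: ler_sum => j _.
  (* At zero weight a logarithm may be taken at 0; the left side is then 0 and the right side
     nonnegative. *)
  have [p0|p0] := eqVneq (a i * q j i) 0.
    rewrite p0 !mul0r !mulr0 subr0 !add0r mulr_ge0 // addr_ge0 //.
      by rewrite mulr_ge0 // mulr_ge0 ?q0.
    by rewrite !mulr_ge0 ?invr_ge0 ?q0.
  have ai : 0 < a i.
    by rewrite lt_def a0 andbT; apply: contraNneq p0 => ->; rewrite mul0r.
  have bj : 0 < b j.
    by rewrite lt_def b0 andbT; apply: contraNneq p0 => /supp ->.
  set x := ln (b j) - ln (a i).
  have -> : a i * q j i - bt * (a i * q j i * x) + bt ^+ 2 / 2 *
     (M ^+ 2 * (a i * q j i) + (2 * M + 1) * expR (- M) * (q j i * b j) +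
     a i * (a i * (q j i / b j))) = a i * q j i * (1 - bt * x + bt ^+ 2 / 2 *
       (M ^+ 2 + (2 * M + 1) * expR (x - M) + expR (- x))).
    have -> : expR (- x) = a i / b j by rewrite /x opprB expRB !lnK.
    have -> : expR (x - M) = expR (- M) * (b j / a i) by rewrite addrC expRD /x expRB !lnK.
    by field; rewrite !gt_eqF.
  by rewrite ler_wpM2l ?mulr_ge0 ?q0 // moment_pointwise.
under eq_bigr do rewrite big_split sumrB -!mulr_sumr !big_split /= -!mulr_sumr.
rewrite big_split sumrB -!mulr_sumr !big_split /= -!mulr_sumr -/h.
have s1 : \sum_i a i * \sum_j q j i = 1.
  by rewrite -[RHS]a1; apply: eq_bigr => i _; rewrite qc mulr1.
have s2 : \sum_i \sum_j q j i * b j = \sum_j b j.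
  by rewrite exchange_big; apply: eq_bigr => j _; rewrite -mulr_suml qr mul1r.
have s3 : \sum_i a i * (a i * \sum_j q j i / b j) <= 1.
  by rewrite -a1; apply: ler_sum => i _; rewrite ler_piMr.
rewrite !s1 s2; apply: lerD => //; rewrite ler_wpM2l //.
have e : (M + 1) ^+ 2 + 1 = M ^+ 2 * 1 + (2 * M + 1) * expR (- M) * expR M + 1.
  by rewrite -mulrA [expR (- M) * _]mulrC expRxMexpNx_1; ring.
by rewrite e; apply: lerD => //; rewrite lerD2l ler_wpM2l.
Qed.

(** Average [x <= expR (x - M) + M - 1]. For [M = 0] this is Klein's inequality; for [M = ln m] it
    bounds the conditional entropy by that of a uniform register. *)
Lemma ns_mean_le T (a b : T -> R) (q : T -> T -> R) (M : R) :
  (forall j i, 0 <= q j i) -> (forall i, \sum_j q j i = 1) -> (forall j, \sum_i q j i = 1) ->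
  (forall i, 0 <= a i) -> (forall i, 0 <= b i) -> \sum_i a i = 1 ->
  \sum_i b i <= expR M -> (forall i j, b j = 0 -> a i * q j i = 0) ->
  \sum_i \sum_j a i * q j i * (ln (b j) - ln (a i)) <= M.
Proof.
move=> q0 qc qr a0 b0 a1 bM supp.
apply: le_trans (_ : \sum_i \sum_j (expR (- M) * (q j i * b j) + (M - 1) * (a i * q j i)) <= _).
  apply: ler_sum => i _; apply: ler_sum => j _.
  have [p0|p0] := eqVneq (a i * q j i) 0.
    by rewrite p0 mul0r mulr0 addr0 mulr_ge0 ?expR_ge0 // mulr_ge0.
  have ai : 0 < a i.
    by rewrite lt_def a0 andbT; apply: contraNneq p0 => ->; rewrite mul0r.
  have bj : 0 < b j.
    by rewrite lt_def b0 andbT; apply: contraNneq p0 => /supp ->.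
  set x := ln (b j) - ln (a i).
  have -> : expR (- M) * (q j i * b j) + (M - 1) * (a i * q j i) =
     a i * q j i * (expR (x - M) + (M - 1)).
    have -> : expR (x - M) = expR (- M) * (b j / a i) by rewrite addrC expRD /x expRB !lnK.
    by field; rewrite !gt_eqF.
  by rewrite ler_wpM2l ?mulr_ge0 //; have := expR_ge1Dx (x - M); lra.
under eq_bigr do rewrite big_split -!mulr_sumr /=.
rewrite big_split -!mulr_sumr /=.
have -> : \sum_i a i * \sum_j q j i = 1.
  by rewrite -[RHS]a1; apply: eq_bigr => i _; rewrite qc mulr1.
have -> : \sum_i \sum_j q j i * b j = \sum_j b j.
  by rewrite exchange_big; apply: eq_bigr => j _; rewrite -mulr_suml qr mul1r.
have := ler_wpM2l (expR_ge0 (- M)) bM.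
have := expRxMexpNx_1 M; rewrite mulrC => -> /=; lra.
Qed.
End NussbaumSzkola.

(** * Tensor powers *)

Section TensorPower.
Variable R : realType.
Local Notation C := R[i].
Implicit Types S T U I : finType.

(** The factors may differ from slot to slot, as the pulse states require; [opow] is the constant
    case. *)
Definition tensor n S T (A : 'I_n -> mx R S T) : mx R {ffun 'I_n -> S} {ffun 'I_n -> T} :=
  fun i j => \prod_(t < n) A t (i t) (j t).

Lemma tensor_mul n S T U (A : 'I_n -> mx R S T) (B : 'I_n -> mx R T U) :
  mxmul (tensor A) (tensor B) = tensor (fun t => mxmul (A t) (B t)).
Proof.
apply: mx_ext => i j; rewrite /mxmul /tensor bigA_distr_bigA.
by apply: eq_bigr => k _; rewrite big_split.
Qed.

Lemma tensor_adj n S T (A : 'I_n -> mx R S T) : adj (tensor A) = tensor (fun t => adj (A t)).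
Proof. by apply: mx_ext => i j; rewrite /adj /tensor rmorph_prod. Qed.

Lemma tensor_rdiag n T (d : 'I_n -> T -> R) :
  tensor (fun t => rdiag (d t)) = rdiag (fun i : {ffun 'I_n -> T} => \prod_t d t (i t)).
Proof.
apply: mx_ext => i j; rewrite /tensor /rdiag /diagop big_split /= rmorph_prod; congr (_ * _).
have [->|ij] := eqVneq i j; first by rewrite big1 // => t _; rewrite eqxx.
have [t tij] : exists t, i t != j t.
  apply/existsP; rewrite -negb_forall; apply: contra ij => /forallP h.
  by apply/eqP/ffunP => t; apply/eqP.
by rewrite (bigD1 t) //= (negPf tij) mul0r.
Qed.

Lemma tensor_id n T : tensor (fun _ : 'I_n => @idop R T) = @idop R {ffun 'I_n -> T}.
Proof.
rewrite -(rdiag1 R {ffun 'I_n -> T}) -(rdiag1 R T) (tensor_rdiag (fun (_ : 'I_n) (_ : T) => 1)).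
by congr rdiag; apply/funext => i; rewrite big1.
Qed.

Lemma tensor_unitary n T (V : 'I_n -> op R T) : (forall t, unitary (V t)) -> unitary (tensor V).
Proof.
move=> h; rewrite /unitary tensor_adj tensor_mul -tensor_id; congr tensor.
by apply/funext => t; apply: h.
Qed.

Lemma normsq_prod I (F : I -> C) : normsq (\prod_i F i) = \prod_i normsq (F i).
Proof.
apply: (big_morph (@normsq R) (@normsqM R)).
by rewrite /normsq /= expr1n expr0n addr0.
Qed.

Lemma sqrt_prod I (F : I -> R) : (forall i, 0 <= F i) ->
  Num.sqrt (\prod_i F i) = \prod_i Num.sqrt (F i).
Proof.
move=> h; rewrite -[RHS]ger0_norm ?prodr_ge0 // -sqrtr_sqr -prodrXl.
by congr Num.sqrt; apply: eq_bigr => i _; rewrite sqr_sqrtr.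
Qed.

Lemma ln_prod I (F : I -> R) : (forall i, 0 < F i) -> ln (\prod_i F i) = \sum_i ln (F i).
Proof.
move=> h; have : 0 < \prod_i F i /\ ln (\prod_i F i) = \sum_i ln (F i); last by case.
elim/big_rec2: _ => [|i y x _ [x0 e]]; first by rewrite ltr01 ln1.
by split; [rewrite mulr_gt0 | rewrite lnM ?posrE // e].
Qed.

(** With [x = t + ln A - ln B] the quotient is the logistic function [1 / (1 + e^-x)]. It is at most
    both 1 and [e^x], hence at most [e^(bt x)] for [bt] in the unit interval, and its square is
    smaller still. *)
Lemma cutoff_le (A B t bt : R) : 0 < A -> 0 < B -> 0 <= bt <= 1 ->
  (A / (A + expR (- t) * B)) ^+ 2 <= expR (bt * t) * expR (- (bt * (ln B - ln A))).
Proof.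
move=> A0 B0 /andP[b0 b1]; pose x := t + ln A - ln B.
have -> : expR (bt * t) * expR (- (bt * (ln B - ln A))) = expR (bt * x).
  by rewrite -expRD; congr expR; rewrite /x; ring.
have eB : expR (- t) * B = A * expR (- x).
  have -> : - x = - t + (ln B - ln A) by rewrite /x; ring.
  by rewrite expRD expRB !lnK ?posrE //; field; rewrite gt_eqF.
have q : A / (A + expR (- t) * B) = (1 + expR (- x))^-1.
  by rewrite eB -{2}[A]mulr1 -mulrDr invfM mulrA divff ?gt_eqF // mul1r.
rewrite q; set y := _^-1.
have d0 : 0 < 1 + expR (- x) by rewrite ltr_wpDl ?expR_gt0.
have y0 : 0 <= y by rewrite invr_ge0 ltW.
have y1 : y <= 1 by rewrite invf_le1 // lerDl expR_ge0.
have yx : y <= expR x.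
  by rewrite -[expR x]invrK -expRN lef_pV2 ?posrE ?expR_gt0 // lerDr.
have y2 : y ^+ 2 <= y by rewrite expr2 ler_piMr.
have [x0|x0] := leP 0 x.
  by rewrite (le_trans y2) // (le_trans y1) // -expR0 ler_expR mulr_ge0.
by rewrite (le_trans y2) // (le_trans yx) // ler_expR; nra.
Qed.

(** Chernoff's method: on tuples of positive weight [cutoff_le] replaces the squared cutoff by the
    exponential of a sum over slots, and the double sum factors into an [n]-th power. *)
Lemma tail_power (n : nat) T (a b : T -> R) (q : T -> T -> R) (t bt : R) :
  (forall j i, 0 <= q j i) -> (forall i, 0 <= a i) -> (forall i, 0 <= b i) ->
  (forall i j, b j = 0 -> a i * q j i = 0) -> 0 <= bt <= 1 ->
  \sum_(i : {ffun 'I_n -> T}) \sum_(j : {ffun 'I_n -> T})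
    (\prod_s a (i s)) * (\prod_s q (j s) (i s)) *
    ((\prod_s a (i s)) / ((\prod_s a (i s)) + expR (- t) * \prod_s b (j s))) ^+ 2 <=
  expR (bt * t) *
    (\sum_i \sum_j a i * q j i * expR (- (bt * (ln (b j) - ln (a i))))) ^+ n.
Proof.
move=> q0 a0 b0 supp hbt.
have -> : (\sum_i \sum_j a i * q j i * expR (- (bt * (ln (b j) - ln (a i))))) ^+ n =
   \sum_(i : {ffun 'I_n -> T}) \sum_(j : {ffun 'I_n -> T}) \prod_s
     (a (i s) * q (j s) (i s) * expR (- (bt * (ln (b (j s)) - ln (a (i s)))))).
  rewrite -[in LHS](card_ord n) -prodr_const bigA_distr_bigA.
  by apply: eq_bigr => i _; rewrite bigA_distr_bigA.
rewrite mulr_sumr; apply: ler_sum => i _; rewrite mulr_sumr; apply: ler_sum => j _.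
rewrite -big_split /=.
have [/existsP[s /eqP hs]|] := boolP [exists s, a (i s) * q (j s) (i s) == 0].
  rewrite (bigD1 s) //= hs !mul0r mulr_ge0 ?expR_ge0 //.
  by apply: prodr_ge0 => k _; rewrite !mulr_ge0 ?expR_ge0.
rewrite negb_exists => /forallP nz.
have apos s : 0 < a (i s).
  by rewrite lt_def a0 andbT; apply: contraNneq (nz s) => ->; rewrite mul0r.
have bpos s : 0 < b (j s).
  by rewrite lt_def b0 andbT; apply: contraNneq (nz s) => /supp ->.
rewrite [X in _ <= _ * X]big_split /= [X in _ <= X]mulrCA ler_wpM2l //.
  by apply: prodr_ge0 => k _; rewrite mulr_ge0.
apply: le_trans (cutoff_le _ _ _ hbt) _; try by apply: prodr_gt0.
rewrite ler_wpM2l ?expR_ge0 // -expR_sum ler_expR sumrN -mulr_sumr sumrB.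
by rewrite !ln_prod.
Qed.

Lemma asymptotic_smoothing K (V W : op R K) (a b : K -> R) (M t s eps : R) (l : nat)
    (u := mxmul (adj W) V)
    (S := mxmul (mxmul W (rdiag b)) (adj W)) (N := mxmul V (rdiag (fun i => Num.sqrt (a i)))) :
  unitary V -> unitary W -> (forall i, 0 <= a i) -> (forall i, 0 <= b i) ->
  \sum_i a i = 1 -> \sum_i b i <= expR M -> 0 <= M -> (0 < M -> ln 2 <= M) ->
  psd (opsub S (mxmul (mxmul V (rdiag a)) (adj V))) ->
  (0 < l)%N -> 0 < eps < 1 -> 0 < s -> l%:R * s ^+ 2 * ln 2 = ln 2 - ln eps -> 0 < t ->
  t + (2 * M + 3 * ln 2) * s <= \sum_i \sum_j a i * normsq (u j i) * (ln (b j) - ln (a i)) ->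
  exists N' : op R {ffun 'I_l -> K}, [/\
    psd (opsub (fun i j => (expR (- t))%:C%C * tensor (fun=> S) i j) (mxmul N' (adj N'))),
    hsnormsq N' <= 1 &
    4 * hsnormsq (fun i j => N' i j - tensor (fun=> N) i j) <= eps ^+ 2].
Proof.
move=> hV hW a0 b0 a1 bM M0 M2 dom l0 he s0 ls t0 th.
have hu : unitary u by apply: unitary_mul => //; apply: unitary_adj.
have quad := domination_quad hW dom.
have supp := domination_supp a0 quad.
have inv := domination_inv a0 b0 quad.
have q0 j i : 0 <= normsq (u j i) by apply: normsq_ge0.
have qc i : \sum_j normsq (u j i) = 1 by apply: unitary_col.
have qr j : \sum_i normsq (u j i) = 1 by apply: unitary_row.
have hM := ns_mean_le q0 qc qr a0 b0 a1 bM supp.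
(* The mean is positive by the hypothesis on [t] and at most [M]. This excludes [M = 0], the case of
   a single pulse position, and makes [ln 2 <= M] available. *)
have M1 : 0 < M.
  have /andP[c0 _] := ln2_bounds R; apply: lt_le_trans hM; apply: lt_le_trans th.
  by rewrite ltr_wpDr // mulr_ge0 ?(ltW s0) //; lra.
have [bt hbt H] := chernoff_parameters l0 he (M2 M1) hM s0 ls t0 th.
have mom := ns_moment q0 qc qr a0 b0 a1 bM M0 supp inv hbt.
have hbt1 : 0 <= bt <= 1 by move/andP: hbt => [? ?]; apply/andP; split; lra.
have [|||||N' [h1 h2 h3]] := @smoothing R {ffun 'I_l -> K} (tensor (fun=> V)) (tensor (fun=> W))
  (fun i : {ffun _} => \prod_k a (i k)) (fun i : {ffun _} => \prod_k b (i k)) (expR (- t)).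
- exact: tensor_unitary.
- exact: tensor_unitary.
- by move=> i; apply: prodr_ge0.
- by move=> i; apply: prodr_ge0.
- exact: expR_gt0.
exists N'; split.
- by move: h1; rewrite tensor_adj -(tensor_rdiag (fun=> b)) !tensor_mul.
- apply: le_trans h2 _; rewrite -(bigA_distr_bigA (fun (_ : 'I_l) x => a x)) big1 //.
- have -> : tensor (fun _ : 'I_l => N) =
    mxmul (tensor (fun=> V)) (rdiag (fun i : {ffun _} => Num.sqrt (\prod_k a (i k)))).
    rewrite -(tensor_mul (fun=> V) (fun=> rdiag (fun i => Num.sqrt (a i)))).
    rewrite (tensor_rdiag (fun _ i => Num.sqrt (a i))); congr (mxmul _ (rdiag _)).
    by apply/funext => i; rewrite sqrt_prod.
  rewrite h3; apply: le_trans (H _ _ mom); last first.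
    by apply: sumr_ge0 => i _; apply: sumr_ge0 => j _; rewrite !mulr_ge0 ?expR_ge0.
  rewrite ler_wpM2l //; apply: le_trans (tail_power l t q0 a0 b0 supp hbt1).
  apply: ler_sum => i _; apply: ler_sum => j _.
  by rewrite tensor_adj tensor_mul /tensor normsq_prod.
Qed.
End TensorPower.

(** * Block-diagonal operators, partial traces and channels *)

Section Blocks.
Variable R : realType.
Local Notation C := R[i].
Implicit Types S T U I : finType.

Lemma psd_scale T (c : R) (A : op R T) : 0 <= c -> psd A -> psd (fun i j => c%:C%C * A i j).
Proof.
move=> c0 h v; rewrite (_ : \sum_i _ = c%:C%C * qform A v).
  by rewrite mulr_ge0 ?ler0c //; apply: h.
rewrite /qform mulr_sumr; apply: eq_bigr => i _; rewrite mulr_sumr; apply: eq_bigr => j _.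
by ring.
Qed.

Lemma psd_sum T I (P : pred I) (A : I -> op R T) :
  (forall k, P k -> psd (A k)) -> psd (fun i j => \sum_(k | P k) A k i j).
Proof.
move=> h v; rewrite (_ : \sum_i _ = \sum_(k | P k) qform (A k) v).
  by apply: sumr_ge0 => k Pk; apply: h.
rewrite /qform [RHS]exchange_big; apply: eq_bigr => i _ /=.
rewrite [RHS]exchange_big; apply: eq_bigr => j _ /=.
by rewrite mulr_sumr mulr_suml.
Qed.

Lemma psd_pullback S T (g : S -> T) (A : op R T) : psd A -> psd (relabel g A).
Proof.
move=> h; pose K : mx R S T := fun s t => (g s == t)%:R.
have -> : relabel g A = mxmul (mxmul K A) (adj K); last exact: psd_sandwich.
have one (B : T -> C) k : \sum_l (k == l)%:R * B l = B k.
  rewrite (bigD1 k) //= big1 => [|l /negPf]; first by rewrite eqxx mul1r addr0.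
  by rewrite eq_sym => ->; rewrite mul0r.
apply: mx_ext => i j; rewrite /mxmul /adj /K.
under eq_bigr do rewrite one rmorph_nat mulrC.
by rewrite one.
Qed.

Lemma psd_tensor n T (A : 'I_n -> op R T) : (forall t, psd (A t)) -> psd (tensor A).
Proof.
move=> h; have sp t := psd_spectral_ex (h t).
pose V t := (projT1 (cid (sp t))).1; pose d t := (projT1 (cid (sp t))).2.
have E t : A t = mxmul (mxmul (V t) (rdiag (d t))) (adj (V t)).
  by rewrite /V /d; case: cid => p [].
have d0 t i : 0 <= d t i.
  by rewrite /d; case: cid => p hp /=; apply: (spectral_ge0 (h t) hp).
have -> : tensor A = mxmul (mxmul (tensor V) (tensor (fun t => rdiag (d t)))) (adj (tensor V)).
  by rewrite tensor_adj !tensor_mul; congr tensor; apply/funext => t.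
by rewrite tensor_rdiag; apply/psd_sandwich/psd_rdiag => i; apply: prodr_ge0.
Qed.

Lemma trace_tensor n T (A : 'I_n -> op R T) : trace (tensor A) = \prod_t trace (A t).
Proof. by rewrite /trace /tensor bigA_distr_bigA. Qed.

Lemma hsnormsq_tensor n S T (A : 'I_n -> mx R S T) : hsnormsq (tensor A) = \prod_t hsnormsq (A t).
Proof.
rewrite /hsnormsq bigA_distr_bigA; apply: eq_bigr => i _; rewrite bigA_distr_bigA.
by apply: eq_bigr => j _; rewrite normsq_prod.
Qed.

Lemma trace_spectral T (V : op R T) d : unitary V ->
  trace (mxmul (mxmul V (rdiag d)) (adj V)) = (\sum_i d i)%:C%C.
Proof.
move=> hV; rewrite trace_mulC mxmulA hV mxmul1l /trace real_sum.
by apply: eq_bigr => i _; rewrite /rdiag /diagop eqxx mul1r.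
Qed.

Lemma trace_sandwich S T (K : mx R S T) (A : op R T) :
  is_isometry K -> trace (mxmul (mxmul K A) (adj K)) = trace A.
Proof. by move=> h; rewrite trace_mulC mxmulA h mxmul1l. Qed.

(** Direct sum over a classical register; a constant family represents [1 (x) A]. *)
Definition blockop I S T (A : I -> mx R S T) : mx R (I * S)%type (I * T)%type :=
  fun p q => (p.1 == q.1)%:R * A p.1 p.2 q.2.

Lemma sum_block (K : nzRingType) I S (x : I) (F : I -> S -> K) :
  \sum_(p : I * S) (x == p.1)%:R * F p.1 p.2 = \sum_s F x s.
Proof.
rewrite -(pair_bigA _ (fun y s => (x == y)%:R * F y s)) /= (bigD1 x) //= [X in _ + X]big1.
  by rewrite addr0; apply: eq_bigr => s _; rewrite eqxx mul1r.
by move=> y /negPf yx; apply: big1 => s _; rewrite eq_sym yx mul0r.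
Qed.

Lemma blockop_mul I S T U (A : I -> mx R S T) (B : I -> mx R T U) :
  mxmul (blockop A) (blockop B) = blockop (fun x => mxmul (A x) (B x)).
Proof.
apply: mx_ext => -[x s] [y u]; rewrite /mxmul /blockop /=.
under eq_bigr do rewrite -mulrA.
rewrite (sum_block x (fun z t => A x s t * ((z == y)%:R * B z t u))) /=.
by rewrite mulr_sumr; apply: eq_bigr => t _; rewrite mulrCA.
Qed.

Lemma blockop_adj I S T (A : I -> mx R S T) : adj (blockop A) = blockop (fun x => adj (A x)).
Proof.
apply: mx_ext => -[x s] [y u]; rewrite /adj /blockop /= conjM rmorph_nat eq_sym.
by have [->|_] := eqVneq x y; rewrite // !mul0r.
Qed.

Lemma blockop_rdiag I S (d : I -> S -> R) :
  blockop (fun x => rdiag (d x)) = rdiag (fun p => d p.1 p.2).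
Proof.
apply: mx_ext => -[x s] [y u]; rewrite /blockop /rdiag /diagop /= mulrA -pair_eqE /=.
by rewrite -natrM mulnb.
Qed.

Lemma blockop_id I S : blockop (fun _ : I => @idop R S) = @idop R (I * S)%type.
Proof. by rewrite -!rdiag1 (blockop_rdiag (fun _ _ => 1)). Qed.

Lemma blockop_isometry I S T (K : I -> mx R S T) : (forall x, is_isometry (K x)) ->
  is_isometry (blockop K).
Proof.
move=> h; rewrite /is_isometry blockop_adj blockop_mul -blockop_id; congr blockop.
by apply/funext => x; apply: h.
Qed.

Lemma psd_blockop I T (A : I -> op R T) : (forall x, psd (A x)) -> psd (blockop A).
Proof.
move=> h; have sp t := psd_spectral_ex (h t).
pose V t := (projT1 (cid (sp t))).1; pose d t := (projT1 (cid (sp t))).2.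
have E t : A t = mxmul (mxmul (V t) (rdiag (d t))) (adj (V t)).
  by rewrite /V /d; case: cid => p [].
have d0 t i : 0 <= d t i.
  by rewrite /d; case: cid => p hp /=; apply: (spectral_ge0 (h t) hp).
have -> : blockop A = mxmul (mxmul (blockop V) (blockop (fun t => rdiag (d t)))) (adj (blockop V)).
  by rewrite blockop_adj !blockop_mul; congr blockop; apply/funext => t.
by rewrite blockop_rdiag; apply/psd_sandwich/psd_rdiag.
Qed.

(** The block of the difference at [x] is the sum of the other [A y]. This gives [T <= S] for the
    probe states and also the trivial bound that the min-entropy is nonnegative. *)
Lemma blockop_le_sum I T (A : I -> op R T) : (forall x, psd (A x)) ->
  psd (opsub (blockop (fun _ : I => fun s t => \sum_y A y s t)) (blockop A)).
Proof.
move=> h; have -> : opsub (blockop (fun _ : I => fun s t => \sum_y A y s t)) (blockop A)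
    = blockop (fun x s t => \sum_(y | y != x) A y s t).
  apply: mx_ext => -[x s] [y t]; rewrite /opsub /blockop /= -mulrBr; congr (_ * _).
  by rewrite (bigD1 x) //= addrAC subrr add0r.
by apply: psd_blockop => x; apply: psd_sum => y _.
Qed.

Lemma isometry_tensor n S T (K : 'I_n -> mx R S T) :
  (forall t, is_isometry (K t)) -> is_isometry (tensor K).
Proof.
move=> h; rewrite /is_isometry tensor_adj tensor_mul -tensor_id; congr tensor.
by apply/funext => t; apply: h.
Qed.

(* Tracing out [B] only moves the index [B] from the rows to the columns of the
   factor, so Hilbert-Schmidt distances of factors are unaffected. *)
Lemma ptr2_gram (A B S J : finType) (g : A * B -> S) (M : mx R S J) :
  ptr2 (relabel g (mxmul M (adj M))) =
  mxmul (fun a (bj : B * J) => M (g (a, bj.1)) bj.2)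
        (adj (fun a (bj : B * J) => M (g (a, bj.1)) bj.2)).
Proof.
apply: mx_ext => a a'; rewrite /ptr2 /relabel /mxmul /adj /=.
by rewrite (pair_bigA _ (fun b j => M (g (a, b)) j * conjc (M (g (a', b)) j))).
Qed.

Lemma hsnormsq_reshape (A B S J : finType) (g : A * B -> S) (M : mx R S J) :
  bijective g -> hsnormsq (fun a (bj : B * J) => M (g (a, bj.1)) bj.2) = hsnormsq M.
Proof.
move=> bg; rewrite /hsnormsq [RHS](reindex g) /=; last exact: onW_bij.
transitivity (\sum_a \sum_b \sum_j normsq (M (g (a, b)) j)); last first.
  by rewrite (pair_bigA _ (fun a b => \sum_j normsq (M (g (a, b)) j))); apply: eq_bigr => -[].
by apply: eq_bigr => a _; rewrite (pair_bigA _ (fun b j => normsq (M (g (a, b)) j))).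
Qed.

Lemma psd_ptr2 (A B : finType) (X : op R (A * B)%type) : psd X -> psd (ptr2 X).
Proof.
move=> h; rewrite /ptr2; apply: (@psd_sum A B predT (fun b i j => X (i, b) (j, b))).
by move=> b _; apply: (psd_pullback (fun a => (a, b)) h).
Qed.

Definition ptr1 (A B : finType) (X : op R (A * B)%type) : op R B :=
  fun i j => \sum_a X (a, i) (a, j).

Lemma psd_ptr1 (A B : finType) (X : op R (A * B)%type) : psd X -> psd (ptr1 X).
Proof.
move=> h; rewrite /ptr1; apply: (@psd_sum B A predT (fun a i j => X (a, i) (a, j))).
by move=> b _; apply: (psd_pullback (fun a => (b, a)) h).
Qed.

Lemma trace_ptr1 (A B : finType) (X : op R (A * B)%type) : trace (ptr1 X) = trace X.
Proof.
rewrite /trace /ptr1 exchange_big /= (pair_bigA _ (fun a b => X (a, b) (a, b))).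
by apply: eq_bigr => -[].
Qed.

(** The reindexing that occurs in the theorem, for arbitrary systems: slotwise triples become a
    triple of tuples, with the system to be traced out placed last. *)
Definition regroup (l : nat) (X G E : finType)
    (p : ({ffun 'I_l -> X} * {ffun 'I_l -> E}) * {ffun 'I_l -> G}) :
    {ffun 'I_l -> (X * (G * E))%type} :=
  [ffun t => (p.1.1 t, (p.2 t, p.1.2 t))].

Lemma regroup_bij l X G E : bijective (@regroup l X G E).
Proof.
exists (fun s : {ffun 'I_l -> (X * (G * E))%type} => (([ffun t => (s t).1], [ffun t => (s t).2.2]),
  [ffun t => (s t).2.1])).
  move=> [[x e] q]; congr ((_, _), _); apply/ffunP => t; rewrite !ffunE //=.
move=> s; apply/ffunP => t; rewrite !ffunE /=; by case: (s t) => ? [].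
Qed.

Lemma ptr2_regroup (l : nat) (X G E : finType) (B : X -> op R (G * E)%type) :
  ptr2 (relabel (@regroup l X G E) (tensor (fun=> blockop B))) =
  blockop (fun x : {ffun 'I_l -> X} => tensor (fun t => ptr1 (B (x t)))).
Proof.
apply: mx_ext => -[x e] [y f]; rewrite /ptr2 /relabel /tensor /blockop /=.
under eq_bigr => q _ do under eq_bigr => t _ do rewrite !ffunE /=.
under eq_bigr do rewrite big_split /=.
rewrite -mulr_sumr; congr (_ * _); last first.
  by rewrite bigA_distr_bigA.
have [->|ij] := eqVneq x y; first by rewrite big1 // => t _; rewrite eqxx.
have [t tij] : exists t, x t != y t.
  apply/existsP; rewrite -negb_forall; apply: contra ij => /forallP h.
  by apply/eqP/ffunP => t; apply/eqP.
by rewrite (bigD1 t) //= (negPf tij) mul0r.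
Qed.
End Blocks.

(** * Channels, their tensor powers, and pure states *)

Section Channels.
Variable R : realType.
Local Notation C := R[i].
Variables (Q : finType) (E : op R Q -> op R Q) (HE : is_channel E).

Lemma channel_sum (J : Type) (r : seq J) (c : J -> C) (B : J -> op R Q) :
  E (fun i j => \sum_(k <- r) c k * B k i j) = fun i j => \sum_(k <- r) c k * E (B k) i j.
Proof.
case: HE => lin _; elim: r => [|k r IH].
  (* Linearity at [c = -1] and [A = B = 0] yields [E 0 = - E 0 + E 0 = 0], the case of the empty
     sum. *)
  have /(_ (-1) (fun _ _ => 0) (fun _ _ => 0)) := lin.
  have e (A : op R Q) : (fun i j => -1 * A i j + A i j) = (fun _ _ => 0).
    by apply: mx_ext => i j; rewrite mulN1r addNr.
  rewrite !e => h.
  transitivity (E (fun _ _ => 0)); first by congr E; apply: mx_ext => i j; rewrite big_nil.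
  by rewrite h; apply: mx_ext => i j; rewrite big_nil.
transitivity (E (fun i j => c k * B k i j + \sum_(k <- r) c k * B k i j)).
  by congr E; apply: mx_ext => i j; rewrite big_cons.
by rewrite lin IH; apply: mx_ext => i j; rewrite big_cons.
Qed.

Lemma channel_expand (A : op R Q) :
  E A = fun i j => \sum_k \sum_l A k l * E (eunit R k l) i j.
Proof.
have e : A = fun i j => \sum_(p : Q * Q) A p.1 p.2 * eunit R p.1 p.2 i j.
  apply: mx_ext => i j; rewrite (bigD1 (i, j)) //= big1 => [|[k l] n].
    by rewrite /eunit !eqxx mulr1 addr0.
  by rewrite /eunit /= [i == k]eq_sym [j == l]eq_sym -xpair_eqE (negPf n) mulr0.
rewrite {1}e channel_sum; apply: mx_ext => i j.
by rewrite (pair_bigA _ (fun k l => A k l * E (eunit R k l) i j)).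
Qed.

Lemma chanpow_tensor n (A : 'I_n -> op R Q) : chanpow E (tensor A) = tensor (fun t => E (A t)).
Proof.
apply: mx_ext => i j; rewrite /chanpow /tensor.
under [RHS]eq_bigr do rewrite channel_expand.
rewrite bigA_distr_bigA; apply: eq_bigr => k _; rewrite bigA_distr_bigA.
by apply: eq_bigr => l _; rewrite big_split.
Qed.

(** Complete positivity with the one-dimensional reference system [unit]. *)
Lemma channel_psd (A : op R Q) : psd A -> psd (E A).
Proof.
case: HE => _ [_ cp] h; have := cp unit (fun p q => A p.2 q.2).
move=> /(_ (psd_pullback (fun p : unit * Q => p.2) h)).
by move=> /(psd_pullback (fun q : Q => (tt, q))).
Qed.

Lemma channel_trace (A : op R Q) : trace (E A) = trace A.
Proof. by case: HE => _ [tr _]; apply: tr. Qed.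
End Channels.

Section KetBra.
Variable R : realType.

Lemma ketbra_psd (T : finType) (v : T -> R[i]) : psd (ketbra v).
Proof.
have -> : ketbra v = mxmul (fun i (_ : unit) => v i) (adj (fun i (_ : unit) => v i)).
  by apply: mx_ext => i j; rewrite /ketbra /mxmul /adj (big_pred1 tt) //; case.
exact: psd_gram.
Qed.

Lemma ketbra_trace (T : finType) (v : T -> R[i]) : unit_vec v -> trace (ketbra v) = 1.
Proof. by move=> <-; apply: eq_bigr => i _; rewrite /ketbra mulrC. Qed.
End KetBra.

(** * The entropy of the pulse ensemble *)

Section Entropy.
Variable R : realType.
Local Notation C := R[i].
Implicit Types S T U I : finType.

(** The logarithm of the product splits unless some factor of [g] is 0, and then the weight is 0
    too. In the summand for slot [t] the other slots sum to 1. *)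
Lemma ln_prod_mean n T (f g : 'I_n -> T -> R) :
  (forall t k, 0 <= g t k) -> (forall t, \sum_k f t k = 1) ->
  (forall t k, g t k = 0 -> f t k = 0) ->
  \sum_(i : {ffun 'I_n -> T}) (\prod_t f t (i t)) * ln (\prod_t g t (i t)) =
  \sum_t \sum_k f t k * ln (g t k).
Proof.
move=> g0 f1 fg.
transitivity (\sum_(i : {ffun 'I_n -> T}) \sum_t (\prod_s f s (i s)) * ln (g t (i t))).
  apply: eq_bigr => i _; rewrite -mulr_sumr.
  have [/existsP[s /eqP hs]|] := boolP [exists s, g s (i s) == 0].
    by rewrite (bigD1 s) //= (fg _ _ hs) !mul0r.
  rewrite negb_exists => /forallP nz; congr (_ * _); apply: ln_prod => s.
  by rewrite lt_def g0 nz.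
rewrite exchange_big /=; apply: eq_bigr => t _.
(* Spread over all slots, with 1 away from [t], the logarithm becomes a product and the sum over
   tuples factors. *)
transitivity (\sum_(i : {ffun 'I_n -> T})
   \prod_s (f s (i s) * (if s == t then ln (g s (i s)) else 1))).
  apply: eq_bigr => i _; rewrite big_split /=; congr (_ * _).
  by rewrite (bigD1 t) //= eqxx big1 ?mulr1 // => s /negPf ->.
rewrite -(bigA_distr_bigA (fun s k => f s k * (if s == t then ln (g s k) else 1))).
rewrite (bigD1 t) //= eqxx [X in _ * X]big1 ?mulr1 // => s /negPf st.
by rewrite -[RHS](f1 s) st; apply: eq_bigr => k _; rewrite mulr1.
Qed.

Lemma sandwich_diag S T (g : mx R S T) (d : T -> R) k :
  mxmul (mxmul g (rdiag d)) (adj g) k k = (\sum_l d l * normsq (g k l))%:C%C.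
Proof.
rewrite /rdiag mxmul_diagr real_sum; apply: eq_bigr => l _.
by rewrite /adj real_complexM normsqE; ring.
Qed.

Lemma normsq_blockop I S T (A : I -> mx R S T) p q :
  normsq (blockop A p q) = (p.1 == q.1)%:R * normsq (A p.1 p.2 q.2).
Proof.
by rewrite /blockop; case: eqP => _; rewrite ?mul1r // !mul0r normsq0.
Qed.

(** The vector [A V0 e_k] equals [B w] for some [w], and the [k]-th coordinate of [B w] in the basis
    [V0] carries the factor [b k]. *)
Lemma supp_diag T (A B V0 : op R T) (b : T -> R) k :
  unitary V0 -> B = mxmul (mxmul V0 (rdiag b)) (adj V0) -> supp_incl A B ->
  b k = 0 -> mxmul (mxmul (adj V0) A) V0 k k = 0.
Proof.
move=> hV eB /(_ (fun j => V0 j k)) [w hw] bk.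
rewrite -mxmulA /mxmul; under eq_bigr do rewrite hw.
transitivity (mxmul (adj V0) (mxmul B (fun j (_ : unit) => w j)) k tt); first by [].
rewrite eB !mxmulA hV mxmul1l -mxmulA /rdiag mxmul_diagl.
by rewrite bk mul0r.
Qed.

Section PulseEntropy.
(* The Boolean says whether the slot carries the pulse. *)
Variables (Q : finType) (m : nat) (rho V : bool -> op R Q) (a : bool -> Q -> R).
Hypothesis m_gt0 : (0 < m)%N.
Hypothesis VU : forall b, unitary (V b).
Hypothesis rhoE : forall b, rho b = mxmul (mxmul (V b) (rdiag (a b))) (adj (V b)).
Hypothesis a_ge0 : forall b k, 0 <= a b k.
Hypothesis a_sum : forall b, \sum_k a b k = 1.
Hypothesis supp : supp_incl (rho true) (rho false).

Local Notation G := {ffun 'I_m -> Q}.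

Definition pulse (x : 'I_m) : op R G := tensor (fun t => rho (t == x)).
Definition pulse_mean : op R G := fun i j => \sum_y (m%:R^-1)%:C%C * pulse y i j.
Definition pulse_basis (x : 'I_m) : op R G := tensor (fun t => V (t == x)).
Definition pulse_eig (x : 'I_m) (i : G) : R := \prod_t a (t == x) (i t).

(** Diagonal of [rho b] in the eigenbasis of [rho false] (see [rV]); the relative entropy sees
    [rho true] through it. *)
Let r b k := \sum_l a b l * normsq (mxmul (adj (V false)) (V b) k l).

Lemma pulse_spectral x :
  pulse x = mxmul (mxmul (pulse_basis x) (rdiag (pulse_eig x))) (adj (pulse_basis x)).
Proof.
rewrite /pulse_basis tensor_adj -(tensor_rdiag (fun t => a (t == x))) !tensor_mul.
by congr tensor; apply/funext => t.
Qed.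

Lemma pulse_basisU x : unitary (pulse_basis x).
Proof. by apply: tensor_unitary. Qed.

Lemma pulse_eig_ge0 x i : 0 <= pulse_eig x i.
Proof. by apply: prodr_ge0. Qed.

Lemma pulse_eig_sum x : \sum_i pulse_eig x i = 1.
Proof.
by rewrite /pulse_eig -(bigA_distr_bigA (fun t => a (t == x))) big1.
Qed.

Lemma pulse_psd x : psd (pulse x).
Proof. by rewrite pulse_spectral; apply/psd_sandwich/psd_rdiag/pulse_eig_ge0. Qed.

Lemma pulse_mean_psd : psd pulse_mean.
Proof.
apply: (@psd_sum R G 'I_m predT (fun y i j => (m%:R^-1)%:C%C * pulse y i j)) => y _.
by apply: psd_scale (pulse_psd y); rewrite invr_ge0.
Qed.

Let rV b k : mxmul (mxmul (adj (V false)) (rho b)) (V false) k k = (r b k)%:C%C.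
Proof. by rewrite -sandwich_diag adj_mul adjK rhoE !mxmulA. Qed.

Let r_sum b : \sum_k r b k = 1.
Proof.
rewrite /r exchange_big -[RHS](a_sum b); apply: eq_bigr => l _ /=.
rewrite -mulr_sumr unitary_col ?mulr1 //.
by apply: unitary_mul => //; apply: unitary_adj.
Qed.

Let r_false k : r false k = a false k.
Proof.
apply: (@complexI R); rewrite -rV rhoE !mxmulA VU mxmul1l -mxmulA VU mxmul1r.
by rewrite /rdiag /diagop eqxx mul1r.
Qed.

Let r_supp b k : a false k = 0 -> r b k = 0.
Proof.
case: b => h; last by rewrite r_false.
by apply: (@complexI R); rewrite -rV (supp_diag (VU false) (rhoE false) supp h).
Qed.

(* The contributions of the slots without a pulse, collected in [Z x], cancel
   between the entropy of [pulse x] and Klein's inequality. *)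
Lemma pulse_entropy (W : op R G) (w : G -> R) :
  unitary W -> pulse_mean = mxmul (mxmul W (rdiag w)) (adj W) ->
  (forall j, 0 <= w j) -> \sum_j w j = 1 ->
  ln m%:R + \sum_k r true k * ln (a false k) - \sum_k a true k * ln (a true k) <=
  \sum_(p : 'I_m * G) \sum_(q : 'I_m * G) (m%:R^-1 * pulse_eig p.1 p.2) *
    normsq (mxmul (adj (blockop (fun=> W))) (blockop pulse_basis) q p) *
    (ln (w q.2) - ln (m%:R^-1 * pulse_eig p.1 p.2)).
Proof.
move=> hW eW w0 w1.
have mR : 0 < m%:R :> R by rewrite ltr0n.
pose s x j i := normsq (mxmul (adj W) (pulse_basis x) j i).
have sc x i : \sum_j s x j i = 1.
  by apply: unitary_col; apply: unitary_mul (pulse_basisU x); apply: unitary_adj.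
pose Z x := \sum_(t : 'I_m | t != x) \sum_k a false k * ln (a false k).
pose H1 := \sum_k a true k * ln (a true k).
pose R1 := \sum_k r true k * ln (a false k).
have eigE x : \sum_i pulse_eig x i * ln (pulse_eig x i) = H1 + Z x.
  rewrite /pulse_eig (@ln_prod_mean m Q (fun t => a (t == x)) (fun t => a (t == x))) //.
  by rewrite (bigD1 x) //= eqxx; congr (_ + _); apply: eq_bigr => t /negPf ->.
have mean i k (K : op R G) : mxmul (mxmul (adj K) pulse_mean) K i k =
   \sum_x (m%:R^-1)%:C%C * mxmul (mxmul (adj K) (pulse x)) K i k.
  have e : pulse_mean = fun i j => \sum_x (m%:R^-1)%:C%C * pulse x i j by [].
  rewrite e /mxmul; under [RHS]eq_bigr do rewrite mulr_sumr.
  rewrite [RHS]exchange_big; apply: eq_bigr => j _ /=.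
  under [RHS]eq_bigr do rewrite mulrA.
  rewrite -mulr_suml; congr (_ * _).
  under [RHS]eq_bigr do rewrite mulr_sumr.
  rewrite [RHS]exchange_big; apply: eq_bigr => j' _ /=.
  by rewrite mulr_sumr; apply: eq_bigr => x _; rewrite mulrCA.
have wE j : \sum_x m%:R^-1 * \sum_i pulse_eig x i * s x j i = w j.
  apply: (@complexI R); rewrite real_sum.
  transitivity (mxmul (mxmul (adj W) pulse_mean) W j j); last first.
    rewrite eW !mxmulA hW mxmul1l -mxmulA hW mxmul1r.
    by rewrite /rdiag /diagop eqxx mul1r.
  rewrite mean; apply: eq_bigr => x _; rewrite real_complexM -sandwich_diag; congr (_ * _).
  by rewrite adj_mul adjK pulse_spectral !mxmulA.
(* This is the conditional entropy of the register: [ln m] plus the average entropy of the pulses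
   minus the entropy of their mean. *)
have hE : \sum_(p : 'I_m * G) \sum_(q : 'I_m * G) (m%:R^-1 * pulse_eig p.1 p.2) *
    normsq (mxmul (adj (blockop (fun=> W))) (blockop pulse_basis) q p) *
    (ln (w q.2) - ln (m%:R^-1 * pulse_eig p.1 p.2)) =
   \sum_j w j * ln (w j) - \sum_x m%:R^-1 * (H1 + Z x) + ln m%:R.
  have -> : ln m%:R = \sum_(x < m) m%:R^-1 * \sum_i ln m%:R * pulse_eig x i.
    under eq_bigr do rewrite -mulr_sumr pulse_eig_sum mulr1.
    by rewrite sumr_const card_ord -[RHS]mulr_natr mulrAC mulVf ?mul1r // gt_eqF.
  have -> : \sum_j w j * ln (w j) =
      \sum_x m%:R^-1 * \sum_i \sum_j pulse_eig x i * s x j i * ln (w j).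
    under eq_bigr do rewrite -{1}wE mulr_suml.
    rewrite exchange_big; apply: eq_bigr => x _ /=.
    rewrite [X in _ = _ * X]exchange_big mulr_sumr; apply: eq_bigr => j _ /=.
    by rewrite -mulrA mulr_suml.
  rewrite -sumrB -big_split /= -(pair_bigA _ (fun x i => \sum_(q : 'I_m * G) (m%:R^-1 * pulse_eig x i) *
    normsq (mxmul (adj (blockop (fun=> W))) (blockop pulse_basis) q (x, i)) *
    (ln (w q.2) - ln (m%:R^-1 * pulse_eig x i)))) /=.
  apply: eq_bigr => x _; rewrite -eigE -mulrBr -mulrDr -sumrB -big_split mulr_sumr /=.
  apply: eq_bigr => i _.
  rewrite blockop_adj blockop_mul; under eq_bigr do rewrite normsq_blockop /=.
  transitivity (\sum_(q : 'I_m * G) (x == q.1)%:R * (m%:R^-1 * (pulse_eig x i * s q.1 q.2 i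
     * (ln (w q.2) - ln (m%:R^-1 * pulse_eig x i))))).
    by apply: eq_bigr => q _; rewrite eq_sym /s; ring.
  rewrite (sum_block x (fun y j => m%:R^-1 * (pulse_eig x i * s y j i
     * (ln (w j) - ln (m%:R^-1 * pulse_eig x i))))) -mulr_sumr; congr (_ * _).
  have [z|nz] := eqVneq (pulse_eig x i) 0.
    by rewrite z !big1 => [|j _|j _]; rewrite !(mul0r, mulr0, subr0, addr0).
  have pos : 0 < pulse_eig x i by rewrite lt_def nz pulse_eig_ge0.
  rewrite lnM ?posrE ?invr_gt0 // lnV ?posrE //.
  rewrite -[X in _ = _ - X + _]mulr1 -[X in _ = _ + X]mulr1 -(sc x i) !mulr_sumr -sumrB -big_split /=.
  by apply: eq_bigr => j _; ring.
(* Eigenvalues and eigenbasis of the reference state, [rho false] in every slot. As [B] sums to 1,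
   [ns_mean_le] applies with [M = 0] and compares the pulse mean with it. *)
pose B (i : G) := \prod_t a false (i t).
pose V0 : op R G := tensor (fun=> V false).
pose g := mxmul (adj V0) W.
have gU : unitary g.
  by apply: unitary_mul hW; apply: unitary_adj; apply: tensor_unitary.
have gE i : \sum_j w j * normsq (g i j) = \sum_x m%:R^-1 * \prod_t r (t == x) (i t).
  apply: (@complexI R); rewrite -sandwich_diag adj_mul adjK real_sum.
  transitivity (mxmul (mxmul (adj V0) pulse_mean) V0 i i).
    by rewrite eW /g !mxmulA.
  rewrite mean; apply: eq_bigr => x _; rewrite real_complexM; congr (_ * _).
  rewrite /V0 /pulse tensor_adj !tensor_mul /tensor rmorph_prod.
  by apply: eq_bigr => t _; rewrite rV.
have Bsupp j i : B i = 0 -> w j * normsq (g i j) = 0.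
  move=> /eqP; rewrite prodf_seq_eq0 => /hasP[t _ /= /eqP at0].
  have : \sum_j w j * normsq (g i j) = 0.
    rewrite gE big1 // => x _; rewrite (bigD1 t) //= (r_supp _ at0).
    by rewrite mul0r mulr0.
  move=> /eqP; rewrite psumr_eq0 => [|k _]; last by rewrite mulr_ge0 ?normsq_ge0.
  by move=> /allP /(_ j (mem_index_enum _)) /eqP.
have klein := @ns_mean_le R G w B (fun i j => normsq (g i j)) 0 (fun _ _ => normsq_ge0 _)
  (fun i => unitary_col i gU) (fun j => unitary_row j gU) w0 _ w1 _ Bsupp.
have {klein} : \sum_j \sum_i w j * normsq (g i j) * (ln (B i) - ln (w j)) <= 0.
  apply: klein; first by move=> i; apply: prodr_ge0.
  by rewrite expR0 /B -(bigA_distr_bigA (fun _ : 'I_m => a false)) big1.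
have -> : \sum_j \sum_i w j * normsq (g i j) * (ln (B i) - ln (w j)) =
   \sum_x m%:R^-1 * (R1 + Z x) - \sum_j w j * ln (w j).
  under eq_bigr do under eq_bigr do rewrite mulrBr.
  under eq_bigr do rewrite sumrB.
  rewrite sumrB; congr (_ - _); last first.
    apply: eq_bigr => j _; rewrite -mulr_suml -mulr_sumr.
    by rewrite (unitary_col j gU) mulr1.
  rewrite exchange_big /=; under eq_bigr do rewrite -mulr_suml gE mulr_suml.
  rewrite exchange_big; apply: eq_bigr => x _ /=.
  under eq_bigr do rewrite -mulrA.
  rewrite -mulr_sumr; congr (_ * _).
  rewrite (@ln_prod_mean m Q (fun t => r (t == x)) (fun _ => a false)) //; last first.
    by move=> t k; apply: r_supp.
  rewrite (bigD1 x) //= eqxx; congr (_ + _); apply: eq_bigr => t /negPf ->.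
  by apply: eq_bigr => k _; rewrite r_false.
rewrite hE -/R1 -/H1 => key.
have e : \sum_x m%:R^-1 * (R1 + Z x) - \sum_x m%:R^-1 * (H1 + Z x) = R1 - H1.
  rewrite -sumrB; under eq_bigr do rewrite -mulrBr opprD addrACA subrr addr0.
  by rewrite sumr_const card_ord -[LHS]mulr_natr mulrAC mulVf ?mul1r // gt_eqF.
by move: key e; lra.
Qed.

(** The logarithm in [relent] is taken in the decomposition selected by [spec], so [V] and [a] are
    tied to that choice. *)
Lemma relent_spectral : spec (rho true) = (V true, a true) ->
  spec (rho false) = (V false, a false) ->
  relent (rho true) (rho false) =
  ((\sum_k a true k * ln (a true k) - \sum_k r true k * ln (a false k)) / ln 2)%:E.
Proof.
move=> s1 s0; rewrite /relent asboolT //; congr EFin.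
rewrite /logop /funop s1 s0 /= /opsub mxmulBr.
have tB (A B : op R Q) : trace (fun i j => A i j - B i j) = trace A - trace B.
  by rewrite /trace sumrB.
rewrite tB -!/(rdiag _).
have -> : trace (mxmul (rho true)
    (mxmul (mxmul (V true) (rdiag (fun i => log2 (a true i)))) (adj (V true))))
    = (\sum_k a true k * log2 (a true k))%:C%C.
  rewrite {1}rhoE !mxmulA -(mxmulA (mxmul (V true) _)) VU mxmul1r -(mxmulA (V true)) rdiag_mul.
  exact: trace_spectral.
have -> : trace (mxmul (rho true)
    (mxmul (mxmul (V false) (rdiag (fun i => log2 (a false i)))) (adj (V false))))
    = (\sum_k r true k * log2 (a false k))%:C%C.
  rewrite mxmulA trace_mulC !mxmulA /rdiag mxmul_diagr /trace real_sum.
  by apply: eq_bigr => k _; rewrite rV real_complexM.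
rewrite -rmorphB /= /log2 mulrBl !mulr_suml.
by congr (_ - _); apply: eq_bigr => k _; rewrite mulrA.
Qed.
End PulseEntropy.
End Entropy.

(** * The min-entropy bound *)

Section MinEntropy.
Variable R : realType.
Local Notation C := R[i].

Lemma opsub_sandwich_ptr2 (A B S T : finType) (g : A * B -> S) (K : mx R S T) (c : R)
    (X Y : op R T) :
  ptr2 (relabel g (mxmul (mxmul K (opsub (fun i j => c%:C%C * X i j) Y)) (adj K))) =
  opsub (fun i j => c%:C%C * ptr2 (relabel g (mxmul (mxmul K X) (adj K))) i j)
        (ptr2 (relabel g (mxmul (mxmul K Y) (adj K)))).
Proof.
have e : mxmul (mxmul K (fun i j => c%:C%C * X i j)) (adj K) =
    fun i j => c%:C%C * mxmul (mxmul K X) (adj K) i j.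
  apply: mx_ext => i j; rewrite /mxmul mulr_sumr; apply: eq_bigr => k _.
  by rewrite mulrA mulr_sumr; congr (_ * _); apply: eq_bigr => k' _; rewrite mulrCA.
rewrite sandwichB e; apply: mx_ext => i j; rewrite /ptr2 /relabel /opsub mulr_sumr.
by rewrite -sumrB.
Qed.

Lemma Hmin_smooth_ge (A B : finType) (eps L : R) (rho rb : op R (A * B)%type) (sg : op R B) :
  density sg -> Defs.ball eps rho rb -> 0 < L ->
  psd (opsub (fun p q => L%:C%C * blockop (fun _ : A => sg) p q) rb) ->
  ((- log2 L)%:E <= Hmin_smooth eps rho)%E.
Proof.
move=> hsg hb L0 h; rewrite /Hmin_smooth.
apply: le_trans (_ : (Hmin_rel rb sg <= _)%E).
  apply: ereal_sup_ubound; exists L; split => //.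
by apply: ereal_sup_ubound; exists sg, rb.
Qed.

(** The hypothesis is the square of [2 |N' - N| <= eps], the left side being the bound of
    [tnorm_gram_le]; the centre has trace 1. *)
Lemma ball_gram (T J : finType) (eps : R) (N N' : mx R T J) :
  hsnormsq N = 1 -> hsnormsq N' <= 1 -> 0 <= eps ->
  4 * hsnormsq (fun i j => N' i j - N i j) <= eps ^+ 2 ->
  Defs.ball eps (mxmul N (adj N)) (mxmul N' (adj N')).
Proof.
move=> h1 h2 e0 h; split; first exact: psd_gram.
rewrite trace_mulC -hsnormsqE h1 /= mul1r; apply: le_trans (tnorm_gram_le _ h2) _; first by rewrite h1.
rewrite -ler_sqr ?nnegrE ?mulr_ge0 ?sqrtr_ge0 // exprMn sqr_sqrtr ?hsnormsq_ge0 //.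
by apply: le_trans h; rewrite -natrX.
Qed.
End MinEntropy.

Unset Implicit Arguments.

Theorem theorem3 (R : realType) (Q : finType) (e0 phi : Q -> R[i])
  (He0 : unit_vec e0) (Hphi : unit_vec phi) (Hov : inner phi e0 != 0)
  (E : op R Q -> op R Q) (HE : is_channel E)
  (Hsupp : supp_incl (E (ketbra phi)) (E (ketbra e0)))
  (m l : nat) (Hm : (0 < m)%N) (Hl : (0 < l)%N)
  (Em : finType)
  (U : mx R ({ffun 'I_m -> Q} * Em)%type {ffun 'I_m -> Q})
  (HU : is_isometry U)
  (eta : 'I_m -> R) (Heta : forall x, 0 < eta x < 1) :
  let rho0 := E (ketbra e0) in
  let rho1 := E (ketbra phi) in
  (* \tilde\sigma^x, \tilde\tau^x, \tau^x_{Q^{m_x} E^m} and its marginal *)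
  let sigt (x : 'I_m) : op R {ffun 'I_m -> Q} := fun i j =>
    \prod_(t < m) (if t == x then ketbra phi else ketbra e0) (i t) (j t) in
  let taut x := chanpow E (sigt x) in
  let tauQE x := mxmul (mxmul U (taut x)) (adj U) in
  let tauQ x := ptr2 (tauQE x) in
  (* \rho^0_{Q^{m_x} E^m} and its marginal *)
  let rho0QE := mxmul (mxmul U (opow (n:=m) rho0)) (adj U) in
  let rho0Q := ptr2 rho0QE in
  (* \tau_{X Q^{m_x} E^m} and \sigma = \tau^{\otimes l} *)
  let tauXQE : op R ('I_m * ({ffun 'I_m -> Q} * Em))%type := fun p q =>
    (p.1 == q.1)%:R * ((m%:R)^-1 * tauQE p.1 p.2 q.2) in
  let sigma := opow (n:=l) tauXQE in
  (* regrouping (X^l, E^n, Q^{m_x l}) and marginal on X^l E^n *)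
  let regroup (p : (({ffun 'I_l -> 'I_m} * {ffun 'I_l -> Em}) *
                    {ffun 'I_l -> {ffun 'I_m -> Q}})%type)
      : {ffun 'I_l -> ('I_m * ({ffun 'I_m -> Q} * Em))%type} :=
    [ffun t => (p.1.1 t, (p.2 t, p.1.2 t))] in
  let sigmaXE := ptr2 (relabel regroup sigma) in
  let delta0 := Cdist (ketbra e0) rho0 in
  let delta1 := Cdist (ketbra phi) rho1 in
  let delta := delta0 + delta1 in
  let f0 := fidelity (ketbra e0) (ketbra phi) in
  let lam x := 2 * delta0 +
     Num.sqrt (eta x + 4 * Num.sqrt (eta x) * delta1 + 4 * delta1 ^+ 2) in
  (forall x, fidelity (tauQ x) rho0Q <=
     aleph (lam x) f0 - 2 * Num.sqrt (1 - f0) * delta - delta ^+ 2) ->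
  forall eps : R, 0 < eps < 1 ->
  ((log2 m%:R)%:E - relent rho1 rho0 +
   ((m%:R)^-1 * \sum_(x < m) log2 (1 - eta x)
    - (2 * log2 m%:R + 3) * Num.sqrt ((log2 eps^-1 + 1) / l%:R))%:E
   <= Hmin_smooth eps sigmaXE)%E.
Proof.
move=> rho0 rho1 sigt taut tauQE tauQ rho0QE rho0Q tauXQE sigma regr sigmaXE delta0 delta1 delta f0 lam.
move=> _ eps heps; have [eps0 eps1] := andP heps.
pose ket b := if b then ketbra phi else ketbra e0.
pose rho b := E (ket b).
have ket_psd b : psd (ket b) by case: b; apply: ketbra_psd.
have rho_psd b : psd (rho b) by apply: channel_psd.
have rho_tr b : trace (rho b) = 1.
  by rewrite /rho (channel_trace HE); case: b; apply: ketbra_trace.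
pose V b := (spec (rho b)).1; pose a b := (spec (rho b)).2.
have sp b : spectral (rho b) (spec (rho b)) by apply: specP.
have VU b : unitary (V b) by case: (sp b).
have rhoE b : rho b = mxmul (mxmul (V b) (rdiag (a b))) (adj (V b)) by case: (sp b).
have a_ge0 b k : 0 <= a b k by apply: (spectral_ge0 (rho_psd b) (sp b)).
have a_sum b : \sum_k a b k = 1.
  by apply: (@complexI R); rewrite -(trace_spectral _ (VU b)) -rhoE rho_tr.
have mR : 0 < m%:R :> R by rewrite ltr0n.
pose pm := @pulse_mean R Q m rho.
have pm_psd : psd pm := pulse_mean_psd rhoE a_ge0.
have pm_tr : trace pm = 1.
  rewrite /trace /pm /pulse_mean exchange_big /=.
  rewrite (eq_bigr (fun _ => (m%:R^-1)%:C%C)) => [|y _]; last first.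
    rewrite -mulr_sumr -[RHS]mulr1; congr (_ * _).
    transitivity (trace (@pulse R Q m rho y)); first by [].
    by rewrite /pulse trace_tensor big1.
  by rewrite -real_sum sumr_const card_ord -[X in X%:C%C]mulr_natr mulVf // gt_eqF.
have [[W w] wp] := psd_spectral_ex pm_psd; have w0 := spectral_ge0 pm_psd wp.
have {wp} [/= WU pmE] := wp.
have w1 : \sum_j w j = 1.
  by apply: (@complexI R); rewrite -(trace_spectral _ WU) -pmE pm_tr.
pose G := {ffun 'I_m -> Q}.
pose B (x : 'I_m) : op R (G * Em)%type :=
  mxmul (mxmul U (fun i j => (m%:R^-1)%:C%C * @pulse R Q m rho x i j)) (adj U).
have tauE : tauXQE = blockop B.
  apply: mx_ext => -[x p] [y q]; rewrite /tauXQE /blockop /B /=; congr (_ * _).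
  have -> : m%:R^-1 = (m%:R^-1)%:C%C :> R[i] by rewrite fmorphV rmorph_nat.
  have -> : tauQE x = mxmul (mxmul U (@pulse R Q m rho x)) (adj U).
    rewrite /tauQE /taut /sigt; congr mxmul; congr mxmul.
    exact: (chanpow_tensor HE (fun t => ket (t == x))).
  rewrite /mxmul mulr_sumr; apply: eq_bigr => k _.
  by rewrite mulrA mulr_sumr; congr (_ * _); apply: eq_bigr => k' _; rewrite mulrCA.
pose VT : op R ('I_m * G)%type := blockop (@pulse_basis R Q m V).
pose aT (p : 'I_m * G) : R := m%:R^-1 * @pulse_eig R Q m a p.1 p.2.
pose WS : op R ('I_m * G)%type := blockop (fun=> W).
pose bS (q : 'I_m * G) : R := w q.2.
have VTU : unitary VT by apply: blockop_isometry => x; apply: pulse_basisU.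
have WSU : unitary WS by apply: blockop_isometry.
have aT0 p : 0 <= aT p by rewrite mulr_ge0 ?invr_ge0 // pulse_eig_ge0.
have aT1 : \sum_p aT p = 1.
  rewrite -(pair_bigA _ (fun x i => m%:R^-1 * @pulse_eig R Q m a x i)) /=.
  under eq_bigr do rewrite -mulr_sumr pulse_eig_sum // mulr1.
  by rewrite sumr_const card_ord -[LHS]mulr_natr mulVf // gt_eqF.
(* The dominating operator [1 (x) pm] has trace [m], which fixes [M = ln m]. *)
have bS1 : \sum_q bS q <= expR (ln m%:R).
  rewrite -(pair_bigA _ (fun (x : 'I_m) i => w i)) /= w1.
  by rewrite sumr_const card_ord lnK.
have TE : mxmul (mxmul VT (rdiag aT)) (adj VT) =
    blockop (fun x i j => (m%:R^-1)%:C%C * @pulse R Q m rho x i j).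
  rewrite /aT -(blockop_rdiag (fun x i => m%:R^-1 * @pulse_eig R Q m a x i)).
  rewrite blockop_adj !blockop_mul; congr blockop; apply/funext => x.
  rewrite (pulse_spectral rhoE) /rdiag !mxmul_diagr; apply: mx_ext => i j.
  by rewrite /mxmul mulr_sumr; apply: eq_bigr => k _; rewrite real_complexM; ring.
have SE : mxmul (mxmul WS (rdiag bS)) (adj WS) = blockop (fun=> pm).
  by rewrite /bS -(blockop_rdiag (fun (x : 'I_m) i => w i)) blockop_adj !blockop_mul pmE.
have dom : psd (opsub (mxmul (mxmul WS (rdiag bS)) (adj WS)) (mxmul (mxmul VT (rdiag aT)) (adj VT))).
  rewrite SE TE.
  apply: (blockop_le_sum (A := fun x i j => (m%:R^-1)%:C%C * @pulse R Q m rho x i j)) => x.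
  by apply: psd_scale (pulse_psd rhoE a_ge0 x); rewrite invr_ge0.
pose N := mxmul VT (rdiag (fun p => Num.sqrt (aT p))).
have NN : mxmul N (adj N) = mxmul (mxmul VT (rdiag aT)) (adj VT).
  rewrite /N adj_mul mxmulA -(mxmulA VT) {2}/rdiag adj_diag -/(rdiag _) rdiag_mul.
  by congr (mxmul (mxmul _ (rdiag _)) _); apply/funext => p; rewrite -expr2 sqr_sqrtr.
have N1 : hsnormsq N = 1.
  by apply: (@complexI R); rewrite hsnormsqE trace_mulC NN trace_spectral // aT1.
pose W1 : mx R ('I_m * (G * Em))%type ('I_m * G)%type := blockop (fun=> U).
pose Wl := tensor (fun _ : 'I_l => W1).
have Wiso : is_isometry Wl by apply: isometry_tensor => t; apply: blockop_isometry.
pose M := mxmul Wl (tensor (fun _ : 'I_l => N)).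
have sigmaE : sigma = mxmul M (adj M).
  rewrite /M adj_mul mxmulA -(mxmulA Wl) !tensor_adj !tensor_mul /sigma tauE.
  transitivity (tensor (fun _ : 'I_l => blockop B)); first by [].
  congr tensor; apply/funext => t; rewrite NN TE blockop_adj !blockop_mul.
  by congr blockop.
(* The factor after tracing out Bob's systems: their index joins the columns, as in [ptr2_gram]. *)
pose hat J (X : mx R {ffun 'I_l -> ('I_m * (G * Em))%type} J) :=
  fun p (bj : {ffun 'I_l -> G} * J) => X (@regroup l _ _ _ (p, bj.1)) bj.2.
have sigmaXE_E : sigmaXE = mxmul (hat _ M) (adj (hat _ M)).
  by rewrite /sigmaXE sigmaE; apply: ptr2_gram.
have M1 : hsnormsq (hat _ M) = 1.
  by rewrite hsnormsq_reshape ?(hsnormsq_isometry _ Wiso) ?hsnormsq_tensor ?big1 //; apply: regroup_bij.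
pose s := Num.sqrt ((log2 eps^-1 + 1) / l%:R).
have lR : 0 < l%:R :> R by rewrite ltr0n.
have /andP[c0 c1] := ln2_bounds R; have c_gt0 : 0 < ln (2 : R) by lra.
have ln_eps : ln eps < 0 by apply: ln_lt0.
have log_eps : log2 eps^-1 = - ln eps / ln 2 by rewrite /log2 lnV.
have arg_gt0 : 0 < (log2 eps^-1 + 1) / l%:R.
  by rewrite divr_gt0 // log_eps ltr_wpDl // divr_ge0 // ltW // oppr_gt0.
have s0 : 0 < s by rewrite sqrtr_gt0.
have ls : l%:R * s ^+ 2 * ln 2 = ln 2 - ln eps.
  rewrite sqr_sqrtr ?ltW // log_eps; field; by rewrite !gt_eqF.
pose H1 := \sum_k a true k * ln (a true k).
pose R1 := \sum_k (\sum_l0 a true l0 * normsq (mxmul (adj (V false)) (V true) k l0)) * ln (a false k).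
have relE : relent rho1 rho0 = ((H1 - R1) / ln 2)%:E.
  by apply: (relent_spectral VU rhoE Hsupp); apply: surjective_pairing.
(* The bound to be proved, in natural units and without the terms in [eta]. *)
pose t := ln m%:R + R1 - H1 - (2 * ln m%:R + 3 * ln 2) * s.
have etaN : m%:R^-1 * \sum_(x < m) log2 (1 - eta x) <= 0.
  rewrite mulr_ge0_le0 ?invr_ge0 // sumr_le0 // => x _.
  rewrite /log2 mulr_le0_ge0 ?invr_ge0 ?(ltW c_gt0) // ln_le0 // lerBlDr lerDl.
  by case/andP: (Heta x) => /ltW.
have lhs (y : R) : t / ln 2 <= y -> ((log2 m%:R)%:E - relent rho1 rho0 +
   ((m%:R)^-1 * \sum_(x < m) log2 (1 - eta x)
    - (2 * log2 m%:R + 3) * s)%:E <= y%:E)%E.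
  move=> ty; rewrite relE -EFinB -EFinD lee_fin; apply: le_trans ty.
  have -> : t / ln 2 = log2 m%:R - (H1 - R1) / ln 2 - (2 * log2 m%:R + 3) * s.
    by rewrite /t /log2; field; rewrite gt_eqF.
  by rewrite addrA lerB // gerDl.
(* For [t <= 0] nonnegativity of the min-entropy suffices: without any smoothing, the state is at
   most [1 (x)] its own marginal, so [L = 1] works. *)
have [t0|t0] := leP t 0.
  apply: le_trans (lhs 0 _) _; first by rewrite mulr_le0_ge0 // invr_ge0 ltW.
  have -> : (0 : R) = - log2 1 by rewrite /log2 ln1 mul0r oppr0.
  pose c (x : {ffun 'I_l -> 'I_m}) := tensor (fun t => ptr1 (B (x t))).
  have cE : sigmaXE = blockop c.
    by rewrite /sigmaXE /sigma tauE; apply: ptr2_regroup.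
  have c_psd x : psd (c x).
    apply: psd_tensor => t'; apply: psd_ptr1; apply: psd_sandwich.
    by apply: psd_scale (pulse_psd rhoE a_ge0 _); rewrite invr_ge0.
  apply: (@Hmin_smooth_ge R _ _ eps 1 sigmaXE sigmaXE (fun e f => \sum_x c x e f)) => //.
  - split; first exact: (@psd_sum _ _ _ predT c).
    have : trace sigmaXE = 1 by rewrite sigmaXE_E trace_mulC -hsnormsqE M1.
    move=> <-; rewrite cE /trace exchange_big /= (pair_bigA _ (fun x e => c x e e)).
    by apply: eq_bigr => -[x e] _; rewrite /blockop eqxx mul1r.
  - rewrite sigmaXE_E; apply: ball_gram; rewrite ?M1 ?(ltW eps0) //.
    rewrite /hsnormsq big1 => [|i _]; first by rewrite mulr0 sqr_ge0.
    by rewrite big1 // => j _; rewrite subrr normsq0.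
  - have := blockop_le_sum c_psd; rewrite cE; congr psd; congr opsub.
    by apply: mx_ext => p q; rewrite mul1r.
have lnm0 : 0 <= ln (m%:R : R) by rewrite ln_ge0 // ler1n.
have lnm2 : 0 < ln (m%:R : R) -> ln 2 <= ln (m%:R : R).
  move=> h; rewrite ler_ln ?posrE // ler_nat ltnNge; apply: contraTN h => m1.
  by rewrite (_ : m = 1%N) ?ln1 ?ltxx //; apply/eqP; rewrite eqn_leq m1.
have th : t + (2 * ln m%:R + 3 * ln 2) * s <= \sum_p \sum_q aT p *
    normsq (mxmul (adj WS) VT q p) * (ln (bS q) - ln (aT p)).
  rewrite /t subrK; exact: (pulse_entropy Hm VU rhoE a_ge0 a_sum Hsupp WU pmE w0 w1).
have [N' [hN1 hN2 hN3]] := asymptotic_smoothing VTU WSU aT0 (fun q => w0 q.2) aT1 bS1 lnm0 lnm2 dom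
   Hl heps s0 ls t0 th.
apply: le_trans (lhs (- log2 (expR (- t))) _) _; first by rewrite /log2 expRK mulNr opprK.
pose M' := mxmul Wl N'.
have hatB : (fun i j => hat _ M' i j - hat _ M i j) = hat _ (fun i j => M' i j - M i j) by [].
(* The reference state is the tensor power of Eve's marginal of [U pm U^*]. Applying Eve's
   isometries to the inequality and the distance for [N'], and then tracing out Bob, gives the two
   requirements. *)
apply: (@Hmin_smooth_ge R _ _ eps (expR (- t)) sigmaXE (mxmul (hat _ M') (adj (hat _ M')))
   (tensor (fun=> ptr1 (mxmul (mxmul U pm) (adj U))))).
- split; first by apply: psd_tensor => t'; apply: psd_ptr1; apply: psd_sandwich.
  by rewrite trace_tensor big1 // => t' _; rewrite trace_ptr1 trace_sandwich.
- rewrite sigmaXE_E; apply: ball_gram => //; last 1 first.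
  + rewrite hatB hsnormsq_reshape; last exact: regroup_bij.
    by rewrite /M' /M -mxmulBr hsnormsq_isometry.
  + by rewrite hsnormsq_reshape ?hsnormsq_isometry //; apply: regroup_bij.
  + exact: ltW.
- exact: expR_gt0.
have -> : mxmul (hat _ M') (adj (hat _ M')) =
    ptr2 (relabel (@regroup l _ _ _) (mxmul (mxmul Wl (mxmul N' (adj N'))) (adj Wl))).
  by rewrite mxmulA -(mxmulA (mxmul Wl N')) -adj_mul -/M' ptr2_gram.
have -> : blockop (fun _ : {ffun 'I_l -> 'I_m} =>
      tensor (fun _ : 'I_l => ptr1 (mxmul (mxmul U pm) (adj U)))) =
    ptr2 (relabel (@regroup l _ _ _) (mxmul (mxmul Wl
      (tensor (fun=> mxmul (mxmul WS (rdiag bS)) (adj WS)))) (adj Wl))).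
  rewrite -(ptr2_regroup l (fun _ : 'I_m => mxmul (mxmul U pm) (adj U))) SE.
  congr (ptr2 (relabel _ _)); rewrite /Wl tensor_adj !tensor_mul; congr tensor; apply/funext => t'.
  by rewrite blockop_adj !blockop_mul.
rewrite -opsub_sandwich_ptr2.
exact/psd_ptr2/psd_pullback/psd_sandwich.
Qed.
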